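(* Assume that for every $t$ the local noises $w^1_t,\ldots,w^n_t$ are exchangeable. Let $\varepsilon>0$, let $c_{\max}$ bound the per-step cost, and let $k\in\mathbb{N}$ satisfy $k\ge\log\!\big(\tfrac{(1-\gamma)\varepsilon}{2c_{\max}}\big)/\log\gamma$. Run the following Q-learning procedure: $Q_1(x,y,a)=0$, and at iteration $\tau$, for a state $(x,y)\in\mathcal{M}(n)\times\{0,\ldots,k\}$ and action $a\in\{0,1\}$, $$Q_{\tau+1}(x,y,a)=(1-\alpha_\tau(x,y,a))Q_\tau(x,y,a)+\alpha_\tau(x,y,a)\big(c'+\gamma\min_{a'\in\{0,1\}}Q_\tau(x',y',a')\big),$$ where $c'$ is the immediate cost incurred, $(x',y')=\tilde f(x,y,o)$ with $o$ the observation received next, and learning rates $\alpha_\tau(x,y,a)\in[0,1]$ satisfy $\sum_\tau\alpha_\tau(x,y,a)=\infty$ and $\sum_\tau\alpha_\tau(x,y,a)^2<\infty$. Suppose every pair $(x,y)\in\mathcal{M}(n)\times\{0,\ldots,k\}$, $a\in\{0,1\}$ is updated infinitely often. Then (a) for every $(x,y,a)$, $Q_\tau(x,y,a)\to Q^\ast(x,y,a)$ with probability one; (b) any greedy strategy $g^\ast_\varepsilon(x,y)\in\arg\min_{a}Q^\ast(x,y,a)$ is $\varepsilon$-optimal, i.e. $J(g^\ast_\varepsilon)\le J(g)+\varepsilon$ for every strategy $g$, and this holds even when the model $(f,q,c,$ noise distribution$)$ is not known.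
   Context: Setting: $n$ nodes with states $s^i_t$ in a finite set $\mathcal{S}\subset\mathbb{R}$, time $t\in\mathbb{N}$; empirical distribution $m_t(s)=\frac1n\sum_i\mathbb{1}\{s^i_t=s\}\in\mathcal{M}(n)$ (probability vectors on $\mathcal{S}$ with entries in $\{0,\frac1n,\ldots,1\}$); dynamics $s^i_{t+1}=f(s^i_t,m_t,w^i_t)$, local noise $w^i_t$ in a finite set $\mathcal{W}$. Action $a_t\in\{0,1\}$ (1 = collect). Observations $o_t\in\mathcal{O}=\mathcal{M}(n)\cup\{\mathtt{blank}\}$: $o_1=m_1$; $a_t=0\Rightarrow o_{t+1}=\mathtt{blank}$; $a_t=1\Rightarrow o_{t+1}=m_{t+1}$ w.p. $q\in[0,1]$, else $\mathtt{blank}$. Strategies $a_t=g_t(o_{1:t},a_{1:t-1})$. Primitive random variables are mutually independent with finite variances. Estimate $\hat m_t=h(\mathbb{P}(m_t\mid o_{1:t},a_{1:t-1}))$ for fixed $h$; per-step cost $c(m_t,\hat m_t,a_t)\ge0$; $J(g)=\mathbb{E}^g[\sum_t\gamma^{t-1}c(m_t,\hat m_t,a_t)]$, $\gamma\in(0,1)$. $T_{\mathsf m}(m',m)=\mathbb{P}(m_{t+1}=m'\mid m_t=m)$ is the transition matrix of the Markov chain $m_t$, $T_{\mathsf m}^y$ its $y$-th power. $\hat c(x,y,a)=\sum_{m}c(m,h(T_{\mathsf m}^y(\cdot,x)),a)T_{\mathsf m}^y(m,x)$. Fix $m^\ast\in\mathcal{M}(n)$ and define $\tilde f(x,y,o)=(x,y+1)$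 if $o=\mathtt{blank}$ and $y<k$; $=(m^\ast,0)$ if $o=\mathtt{blank}$ and $y=k$; $=(o,0)$ if $o\ne\mathtt{blank}$. $\mathbb{P}(o\mid x,y,a)=(1-aq)\mathbb{1}\{o=\mathtt{blank}\}+aqT_{\mathsf m}^{y+1}(o,x)\mathbb{1}\{o\neq\mathtt{blank}\}$. $Q^\ast$ is the unique function on $\mathcal{M}(n)\times\{0,\ldots,k\}\times\{0,1\}$ satisfying $Q^\ast(x,y,a)=\hat c(x,y,a)+\gamma\sum_{o\in\mathcal{O}}\mathbb{P}(o\mid x,y,a)\min_{a'}Q^\ast(\tilde f(x,y,o),a')$. *)

(* Defs.v *)
From HB Require Import structures.
From mathcomp Require Import all_boot all_order all_algebra.
From mathcomp Require Import perm.
From mathcomp Require Import all_classical all_reals all_analysis.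
Set Implicit Arguments. Unset Strict Implicit. Unset Printing Implicit Defensive.
Import Order.TTheory GRing.Theory Num.Theory.
Local Open Scope ring_scope.

(* Empirical distributions M(n).  An element m of M(n) is encoded by   *)
(* its vector of counts n*m(s) in {0,..,n} (summing to n); m(s) is     *)
(* count(s)/n.  This is a bijective encoding of M(n).                  *)
Definition Mn (n : nat) (S : finType) :=
  {m : {ffun S -> 'I_n.+1} | (\sum_(s : S) (m s : nat) == n)%N}.

Definition mval (R : numFieldType) n (S : finType) (m : Mn n S) (s : S) : R :=
  ((sval m s : nat)%:R / n%:R).

Definition Cfg (n : nat) (S : finType) := {ffun 'I_n -> S}.

(* observations: Some m = an observed empirical distribution, None = blank *)
Definition obs n S := option (Mn n S).

Lemma emp_proof n (S : finType) (c : Cfg n S) :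
  (\sum_(s : S) (([ffun s => inord #|[set i | c i == s]|] : {ffun S -> 'I_n.+1}) s : nat) == n)%N.
Proof.
apply/eqP.
have H s : ((([ffun s => inord #|[set i | c i == s]|] : {ffun S -> 'I_n.+1}) s : nat)
            = #|[set i | c i == s]|)%N.
  rewrite ffunE inordK // ltnS.
  by apply: leq_trans (max_card _) _; rewrite card_ord.
under eq_bigr do rewrite H.
transitivity (\sum_(s : S) \sum_(i : 'I_n) (c i == s) : nat)%N.
  apply: eq_bigr => s _; rewrite cardsE -sum1_card big_mkcond /=.
  apply: eq_bigr => i _.
  by rewrite -[LHS]/(if c i == s then 1 else 0)%N; case: (c i == s).
rewrite exchange_big /=.
transitivity (\sum_(i : 'I_n) 1)%N; last by rewrite sum1_card card_ord.
apply: eq_bigr => i _.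
by rewrite (bigD1 (c i)) //= eqxx big1 ?addn0 // => s /negbTE; rewrite eq_sym => ->.
Qed.

Definition emp n (S : finType) (c : Cfg n S) : Mn n S :=
  exist (fun m : {ffun S -> 'I_n.+1} => (\sum_(s : S) (m s : nat) == n)%N) _ (emp_proof c).

(* Transition matrix T_m(m',m) = P(m_{t+1} = m' | m_t = m):           *)
(* take any configuration c with empirical distribution m (all such   *)
(* c give the same value under exchangeability) and draw the noise     *)
(* vector w = (w^1,...,w^n) with joint law pw.                         *)
Definition Tm (R : pzRingType) n (S W : finType)
    (f : S -> Mn n S -> W -> S) (pw : {ffun 'I_n -> W} -> R)
    (m' m : Mn n S) : R :=
  match [pick c : Cfg n S | emp c == m] with
  | Some c => \sum_(w : {ffun 'I_n -> W})
                 pw w * (emp [ffun i => f (c i) m (w i)] == m')%:R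
  | None => 0
  end.

Fixpoint Tpow (R : pzRingType) (M : finType) (T : M -> M -> R) (y : nat)
  : M -> M -> R :=
  match y with
  | 0 => fun m' m => (m' == m)%:R
  | y'.+1 => fun m' m => \sum_(z : M) T m' z * Tpow T y' z m
  end.

Definition chat (R : pzRingType) (M : finType) (E : Type)
    (T : M -> M -> R) (cost : M -> E -> bool -> R) (h : (M -> R) -> E)
    (x : M) (y : nat) (a : bool) : R :=
  \sum_(m : M) cost m (h (fun m' => Tpow T y m' x)) a * Tpow T y m x.

Definition ftilde (M : finType) (k : nat) (mstar : M)
    (xy : M * 'I_k.+1) (o : option M) : M * 'I_k.+1 :=
  match o with
  | Some m => (m, ord0)
  | None => if (xy.2 < k)%N then (xy.1, inord xy.2.+1) else (mstar, ord0)
  end.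

Definition Pobs (R : pzRingType) (M : finType) (q : R) (T : M -> M -> R)
    (x : M) (y : nat) (a : bool) (o : option M) : R :=
  (1 - a%:R * q) * (o == None)%:R
  + a%:R * q * (match o with Some m => Tpow T y.+1 m x | None => 0 end).

Definition Bellman (R : realDomainType) (M : finType) (E : Type) (k : nat)
    (mstar : M) (q gamma : R) (T : M -> M -> R) (cost : M -> E -> bool -> R)
    (h : (M -> R) -> E) (Q : M -> 'I_k.+1 -> bool -> R) : Prop :=
  forall x y a,
    Q x y a = chat T cost h x y a
      + gamma * \sum_(o : option M) Pobs q T x y a o *
          Num.min (Q (ftilde mstar (x, y) o).1 (ftilde mstar (x, y) o).2 false)
                  (Q (ftilde mstar (x, y) o).1 (ftilde mstar (x, y) o).2 true).

Definition obsNext (R : pzRingType) (M : finType) (q : R) (T : M -> M -> R)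
    (a : bool) (m : M) (o : option M) : R :=
  if a then q * (match o with Some m' => T m' m | None => 0 end)
            + (1 - q) * (o == None)%:R
  else (o == None)%:R.

Definition obsP (R : pzRingType) (M : finType) (q : R) (a : bool) (m' : M)
    (o : option M) : R :=
  if a then q * (o == Some m')%:R + (1 - q) * (o == None)%:R
  else (o == None)%:R.

Definition Ts (R : pzRingType) n (S W : finType)
    (f : S -> Mn n S -> W -> S) (pw : {ffun 'I_n -> W} -> R)
    (c' c : Cfg n S) : R :=
  \sum_(w : {ffun 'I_n -> W}) pw w * (c' == [ffun i => f (c i) (emp c) (w i)])%:R.

(* strategies a_t = g(o_{1:t}, a_{1:t-1}) *)
Definition strategy n S := seq (obs n S) -> seq bool -> bool.

(* one step of a history: (a_t, s_{t+1}, o_{t+1}) *)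
Definition step n S := (bool * Cfg n S * obs n S)%type.

Fixpoint jw (R : pzRingType) n (S W : finType)
    (f : S -> Mn n S -> W -> S) (pw : {ffun 'I_n -> W} -> R) (q : R)
    (g : strategy n S) (prev : Cfg n S) (os : seq (obs n S)) (as_ : seq bool)
    (st : seq (step n S)) : R :=
  match st with
  | [::] => 1
  | (a, c', o') :: st' =>
      (a == g os as_)%:R * Ts f pw c' prev * obsP q a (emp c') o'
        * jw f pw q g c' (rcons os o') (rcons as_ a) st'
  end.

Definition pathP (R : pzRingType) n (S W : finType)
    (f : S -> Mn n S -> W -> S) (pw : {ffun 'I_n -> W} -> R)
    (p0 : Cfg n S -> R) (q : R) (g : strategy n S)
    (c1 : Cfg n S) (o1 : obs n S) (st : seq (step n S)) : R :=
  p0 c1 * (o1 == Some (emp c1))%:R * jw f pw q g c1 [:: o1] [::] st.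

Definition jointM (R : pzRingType) n (S W : finType)
    (f : S -> Mn n S -> W -> S) (pw : {ffun 'I_n -> W} -> R)
    (p0 : Cfg n S -> R) (q : R) (g : strategy n S)
    (os : seq (obs n S)) (as_ : seq bool) (m : Mn n S) : R :=
  \sum_(c1 : Cfg n S) \sum_(cs : (size as_).-tuple (Cfg n S))
    match os with
    | o1 :: os' => pathP f pw p0 q g c1 o1 (zip (zip as_ cs) os')
                     * (emp (last c1 cs) == m)%:R
    | [::] => 0
    end.

Definition belief (R : fieldType) n (S W : finType)
    (f : S -> Mn n S -> W -> S) (pw : {ffun 'I_n -> W} -> R)
    (p0 : Cfg n S -> R) (q : R) (g : strategy n S)
    (os : seq (obs n S)) (as_ : seq bool) : Mn n S -> R :=
  fun m => jointM f pw p0 q g os as_ m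
           / \sum_(m' : Mn n S) jointM f pw p0 q g os as_ m'.

(* E^g[c(m_{t+1}, \hat m_{t+1}, a_{t+1})] *)
Definition Ecost (R : fieldType) n (S W : finType) (E : Type)
    (f : S -> Mn n S -> W -> S) (pw : {ffun 'I_n -> W} -> R)
    (p0 : Cfg n S -> R) (q : R) (cost : Mn n S -> E -> bool -> R)
    (h : (Mn n S -> R) -> E) (g : strategy n S) (t : nat) : R :=
  \sum_(c1 : Cfg n S) \sum_(o1 : obs n S) \sum_(st : t.-tuple (step n S))
    pathP f pw p0 q g c1 o1 st *
    (let os := o1 :: [seq s.2 | s <- st] in
     let as_ := [seq s.1.1 | s <- st] in
     cost (emp (last c1 [seq s.1.2 | s <- st]))
          (h (belief f pw p0 q g os as_)) (g os as_)).

Definition Jcost (R : realType) n (S W : finType) (E : Type)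
    (f : S -> Mn n S -> W -> S) (pw : {ffun 'I_n -> W} -> R)
    (p0 : Cfg n S -> R) (q gamma : R) (cost : Mn n S -> E -> bool -> R)
    (h : (Mn n S -> R) -> E) (g : strategy n S) : R :=
  limn (fun N => \sum_(t < N) gamma ^+ t * Ecost f pw p0 q cost h g t).

(* the agent's state (x_t, y_t), computed from o_{1:t} via \tilde f, *)
(* started at (x_1, y_1) = (o_1, 0) = (m_1, 0)                        *)
Definition track (M : finType) (k : nat) (mstar : M) (os : seq (option M))
  : M * 'I_k.+1 :=
  foldl (ftilde mstar)
        (match head None os with Some m => m | None => mstar end, ord0)
        (behead os).

Definition greedy_strategy n (S : finType) (k : nat) (mstar : Mn n S)
    (gs : Mn n S -> 'I_k.+1 -> bool) : strategy n S :=
  fun os _ => let xy := track k mstar os in gs xy.1 xy.2.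

(* joint law of (c', o) for a sample at (x,y,a): m ~ T^y(.,x),        *)
(* c' = c(m, h(T^y(.,x)), a), o ~ next observation                    *)
Definition Kco (R : realDomainType) (M : finType) (E : Type) (q : R)
    (T : M -> M -> R) (cost : M -> E -> bool -> R) (h : (M -> R) -> E)
    (x : M) (y : nat) (a : bool) (c' : R) (o : option M) : R :=
  \sum_(m : M) Tpow T y m x * (cost m (h (fun m' => Tpow T y m' x)) a == c')%:R
               * obsNext q T a m o.

(* the sample history before the cost/observation of iteration tau *)
Definition hist (Omega : Type) (R : Type) (M : finType) (k : nat)
    (X : nat -> Omega -> M) (Y : nat -> Omega -> 'I_k.+1)
    (A : nat -> Omega -> bool) (C : nat -> Omega -> R)
    (O : nat -> Omega -> option M) (tau : nat) (w : Omega) :=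
  ([seq (X s w, Y s w, A s w, C s w, O s w) | s <- iota 0 tau],
   (X tau w, Y tau w, A tau w)).

Definition alv (Omega : Type) (R : pzRingType) (M : finType) (k : nat)
    (X : nat -> Omega -> M) (Y : nat -> Omega -> 'I_k.+1)
    (A : nat -> Omega -> bool) (al : nat -> Omega -> R)
    (tau : nat) (x : M) (y : 'I_k.+1) (a : bool) (w : Omega) : R :=
  if (X tau w, Y tau w, A tau w) == (x, y, a) then al tau w else 0.

(* Q-learning iterates: Qit 0 = Q_1 = 0, Qit tau = Q_{tau+1} *)
Fixpoint Qit (Omega : Type) (R : realDomainType) (M : finType) (k : nat)
    (mstar : M) (gamma : R) (X : nat -> Omega -> M) (Y : nat -> Omega -> 'I_k.+1)
    (A : nat -> Omega -> bool) (C : nat -> Omega -> R)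
    (O : nat -> Omega -> option M) (al : nat -> Omega -> R)
    (tau : nat) : Omega -> M -> 'I_k.+1 -> bool -> R :=
  match tau with
  | 0 => fun _ _ _ _ => 0
  | t.+1 => fun w x y a =>
      let Q := Qit mstar gamma X Y A C O al t w in
      let xy' := ftilde mstar (x, y) (O t w) in
      (1 - alv X Y A al t x y a w) * Q x y a
      + alv X Y A al t x y a w
          * (C t w + gamma * Num.min (Q xy'.1 xy'.2 false) (Q xy'.1 xy'.2 true))
  end.

(* Main.v *)
(* (b) Up to time k+1 the tracker (x, y) has not been reset, so under any strategy the conditional law
   of m_t given the history is T^y(., x).  Iterating the Bellman equation k+1 times shows that, with
   B = gamma^(k+1) cmax / (1 - gamma), the expected initial value min_a Qstar(m_1, 0, a) is at most
   J(g) + B for every g and at least J(g) - B for greedy g; and 2 B <= eps.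

   (a) Each update is a step towards the Bellman operator perturbed by martingale noise.  The noise
   sums, weighted by the learning rates, are L2-bounded once they are stopped, hence a.s. Cauchy.  On
   a path where they are Cauchy, removing the partial noise sums leaves a noiseless averaging
   recursion, and the contraction property shrinks every asymptotic bound C on |Q_t - Qstar| to
   gamma C + e. *)
Require Import Defs.
From HB Require Import structures.
From mathcomp Require Import all_boot all_order all_algebra.
From mathcomp Require Import perm ring lra.
From mathcomp Require Import all_classical all_reals all_analysis.
Set Implicit Arguments. Unset Strict Implicit. Unset Printing Implicit Defensive.
Import Order.TTheory GRing.Theory Num.Theory numFieldNormedType.Exports.
Local Open Scope ring_scope.

(** * Empirical distributions and the chain m_t *)

(** Part (b): time indices start at 0, and a reset of the tracker can first occur in the update
    after index k. That update affects only the value left over after k+1 Bellman steps. About this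
    leftover nothing is used beyond its lying in [0, cmax / (1 - gamma)], whence the factor
    gamma^(k+1).

    Part (a): the learning rates are random, and their squares are summable along almost every path
    without any bound in mean. So the noise sums are stopped as soon as the squared rates exceed a
    threshold, and the threshold is shown to be rarely reached from a late starting time on. The
    sampling assumption gives conditional laws only on single histories. Histories are therefore
    recoded as sequences over a finite type, where expectations are finite sums and conditioning is
    one step of summation. *)

Lemma sval_emp n (S : finType) (c : Cfg n S) s :
  (sval (emp c) s : nat) = #|[set i | c i == s]|.
Proof.
rewrite /emp /= ffunE inordK // ltnS.
by apply: leq_trans (max_card _) _; rewrite card_ord.
Qed.

Lemma count_codom_cfg n (S : finType) (c : Cfg n S) s :
  count_mem s [tuple c i | i < n] = #|[set i | c i == s]|.
Proof.
rewrite -map_tnth_enum -map_comp count_map cardsE cardE /enum_mem size_filter -enumT.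
by apply: eq_count => i /=; rewrite tnth_mktuple.
Qed.

Lemma emp_eq_perm n (S : finType) (c c' : Cfg n S) :
  emp c = emp c' -> exists p : 'S_n, c = [ffun i => c' (p i)].
Proof.
move=> e.
have : perm_eq [tuple c i | i < n] [tuple c' i | i < n].
  rewrite /perm_eq; apply/allP => s _ /=; apply/eqP.
  by rewrite !count_codom_cfg -!sval_emp e.
case/tuple_permP => p hp; exists p; apply/ffunP => i; rewrite ffunE.
have /val_inj/(congr1 (fun t => tnth t i)) := hp.
by rewrite !tnth_mktuple.
Qed.

Lemma emp_perm n (S : finType) (c : Cfg n S) (p : 'S_n) :
  emp [ffun i => c (p i)] = emp c.
Proof.
apply: val_inj; apply/ffunP => s; apply: val_inj => /=.
rewrite -!/(sval (emp _) _ : nat).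
have /= -> := sval_emp [ffun i => c (p i)] s.
have /= -> := sval_emp c s.
rewrite -(card_preimset [set i | c i == s]%SET (@perm_inj _ p)).
by apply: eq_card => i; rewrite !inE ffunE.
Qed.

(** List each state as often as its count says. As every type has a representative, the [None]
    branch of [Tm] never occurs and each column of [Tm] sums to 1. *)
Lemma emp_surj n (S : finType) (m : Mn n S) : exists c : Cfg n S, emp c = m.
Proof.
pose s := flatten [seq nseq (sval m x : nat) x | x <- enum S].
have size_s : size s == n.
  rewrite size_flatten /shape -map_comp sumnE big_map.
  under eq_bigr do rewrite /= size_nseq.
  by rewrite big_enum /=; exact: (svalP m).
exists [ffun i => tnth (Tuple size_s) i].
apply: val_inj; apply/ffunP => x; apply: val_inj => /=.
have /= -> := sval_emp [ffun i => tnth (Tuple size_s) i] x.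
rewrite -count_codom_cfg /=.
have -> : [seq [ffun i0 => tnth (Tuple size_s) i0] i | i <- enum 'I_n] = s.
  under eq_map do rewrite ffunE.
  by rewrite map_tnth_enum.
rewrite count_flatten sumnE big_map big_map big_enum /=.
rewrite (bigD1 x) //= count_nseq /= eqxx mul1n big1 ?addn0 // => y /negbTE yx.
by rewrite count_nseq /= yx.
Qed.

Section Model.
Variables (R : realType) (n : nat) (S W : finType).
Variables (f : S -> Mn n S -> W -> S) (pw : {ffun 'I_n -> W} -> R).
Hypothesis pw_ge0 : forall w, 0 <= pw w.
Hypothesis pw_sum : \sum_(w : {ffun 'I_n -> W}) pw w = 1.
Hypothesis pw_exch : forall (sigma : 'S_n) (w : {ffun 'I_n -> W}),
      pw [ffun i => w (sigma i)] = pw w.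

(* Tm is built from an arbitrary configuration of type m; exchangeability makes the choice
   irrelevant, so the empirical distribution is itself a Markov chain. *)
Lemma Tm_emp (c : Cfg n S) m' :
  \sum_(w : {ffun 'I_n -> W}) pw w * (emp [ffun i => f (c i) (emp c) (w i)] == m')%:R
  = Tm f pw m' (emp c).
Proof.
rewrite /Tm; case: pickP => [c0 /eqP e|/(_ c)]; last by rewrite eqxx.
have [p hp] := emp_eq_perm (esym e).
have inj : injective (fun w : {ffun 'I_n -> W} => [ffun i => w (p i)] : {ffun 'I_n -> W}).
  move=> w1 w2 /ffunP h; apply/ffunP => i; have := h (p^-1 i)%g.
  by rewrite !ffunE permKV.
(* The relabelling [p] between the two representatives is moved onto the noise vector:
   exchangeability keeps its weight, and permuting the nodes of the next configuration keeps its
   type. *)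
rewrite (reindex_inj inj) /=; apply: eq_bigr => w _; rewrite pw_exch.
congr (_ * (_ == _)%:R); rewrite -[RHS](emp_perm _ p); congr emp.
by apply/ffunP => i; rewrite !ffunE hp ffunE.
Qed.

Lemma Tm_ge0 m' m : 0 <= Tm f pw m' m.
Proof.
by rewrite /Tm; case: pickP => // c _; apply: sumr_ge0 => w _; rewrite mulr_ge0.
Qed.

Lemma sum_indic (I : finType) (x : I) : \sum_(y : I) (x == y)%:R = 1 :> R.
Proof.
rewrite (bigD1 x) //= eqxx big1 ?addr0 // => y /negbTE; rewrite eq_sym => ->.
by [].
Qed.

Lemma Tm_sum m : \sum_m' Tm f pw m' m = 1.
Proof.
have [c <-] := emp_surj m.
under eq_bigr do rewrite -Tm_emp.
rewrite exchange_big /= -[RHS]pw_sum; apply: eq_bigr => w _.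
by rewrite -mulr_sumr sum_indic mulr1.
Qed.

Lemma Ts_ge0 c' c : 0 <= Ts f pw c' c.
Proof. by apply: sumr_ge0 => w _; rewrite mulr_ge0. Qed.

(** Lumpability of the configuration chain: both sides are sums over the noise vector, and [Tm_emp]
    lets [Tm] be computed from the actual configuration [c]. *)
Lemma Ts_emp (F : Mn n S -> R) c :
  \sum_c' Ts f pw c' c * F (emp c') = \sum_m Tm f pw m (emp c) * F m.
Proof.
transitivity (\sum_(w : {ffun 'I_n -> W}) pw w * F (emp [ffun i => f (c i) (emp c) (w i)])).
  rewrite /Ts; under eq_bigr do rewrite mulr_suml.
  rewrite exchange_big /=; apply: eq_bigr => w _.
  rewrite (bigD1 [ffun i => f (c i) (emp c) (w i)]) //= eqxx mulr1 big1 ?addr0 //.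
  by move=> c' /negbTE ->; rewrite mulr0 mul0r.
under [RHS]eq_bigr do rewrite -Tm_emp mulr_suml.
rewrite exchange_big /=; apply: eq_bigr => w _.
rewrite (bigD1 (emp [ffun i => f (c i) (emp c) (w i)])) //= eqxx mulr1 big1 ?addr0 //.
by move=> c' /negbTE; rewrite eq_sym => ->; rewrite mulr0 mul0r.
Qed.

End Model.

Section Chain.
Variables (R : realType) (M : finType) (T : M -> M -> R).
Hypothesis T_ge0 : forall m' m, 0 <= T m' m.
Hypothesis T_sum : forall m, \sum_m' T m' m = 1.

Lemma Tpow_ge0 y m' m : 0 <= Tpow T y m' m.
Proof.
elim: y m' => [|y IH] m' /=; first by [].
by apply: sumr_ge0 => z _; rewrite mulr_ge0.
Qed.

Lemma Tpow_sum y m : \sum_m' Tpow T y m' m = 1.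
Proof.
elim: y => [|y IH] /=.
  by under eq_bigr do rewrite eq_sym; exact: sum_indic.
rewrite exchange_big /= -[RHS]IH; apply: eq_bigr => z _.
by rewrite -mulr_suml T_sum mul1r.
Qed.

Variables (q : R).
Hypothesis q01 : 0 <= q <= 1.

Lemma Pobs_ge0 x y a o : 0 <= Pobs q T x y a o.
Proof.
case/andP: q01 => q0 q1; rewrite /Pobs addr_ge0 //.
  by rewrite mulr_ge0 // subr_ge0; case: a; rewrite ?mul1r ?mul0r.
by rewrite mulr_ge0 // ?mulr_ge0 //; case: o => // m; exact: (Tpow_ge0 y.+1).
Qed.

Lemma sum_option (F : option M -> R) :
  \sum_o F o = F None + \sum_m F (Some m).
Proof.
rewrite (bigD1 None) //=; congr (_ + _).
rewrite (reindex_omap Some id) //=; last by case.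
by apply: eq_bigl => m; rewrite eqxx.
Qed.

Lemma Pobs_sum x y a : \sum_o Pobs q T x y a o = 1.
Proof.
rewrite sum_option /Pobs eqxx mulr1 mulr0 addr0.
under eq_bigr do rewrite mulr0 add0r.
by rewrite -mulr_sumr (Tpow_sum y.+1) mulr1 subrK.
Qed.

Lemma obsP_ge0 a (m : M) o : 0 <= obsP q a m o.
Proof.
case/andP: q01 => q0 q1; rewrite /obsP; case: a => //.
by rewrite addr_ge0 // mulr_ge0 // subr_ge0.
Qed.

Lemma obsP_sum a (m : M) : \sum_o obsP q a m o = 1.
Proof.
rewrite sum_option /obsP; case: a => /=; last by rewrite big1 ?addr0.
rewrite mulr0 add0r mulr1.
under eq_bigr => i _ do rewrite mulr0 addr0 -[Some i == _]/(i == m) eq_sym.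
by rewrite -mulr_sumr sum_indic mulr1 subrK.
Qed.

End Chain.

(** * Conditioning on observations *)

Lemma big_tuple_cons (R : nmodType) (T : finType) t (F : seq T -> R) :
  \sum_(s : t.+1.-tuple T) F s = \sum_x \sum_(s : t.-tuple T) F (x :: s).
Proof.
rewrite pair_big /=.
rewrite (reindex (fun p : T * t.-tuple T => [tuple of p.1 :: p.2])) //=.
exists (fun s : t.+1.-tuple T => (thead s, [tuple of behead s])) => [[x s] _|s _] /=.
  by congr (_, _); apply: val_inj.
by rewrite [RHS]tuple_eta.
Qed.

Lemma big_tuple_rcons (R : nmodType) (T : finType) t (F : seq T -> R) :
  \sum_(s : t.+1.-tuple T) F s = \sum_(s : t.-tuple T) \sum_x F (rcons s x).
Proof.
elim: t F => [|t IH] F.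
  rewrite big_tuple_cons exchange_big /=.
  apply: eq_bigr => s _; apply: eq_bigr => x _; by rewrite tuple0.
rewrite big_tuple_cons; under eq_bigr do rewrite (IH (fun s => F (_ :: s))).
by rewrite (big_tuple_cons _ (fun s => \sum_x F (rcons s x))).
Qed.

Lemma big_tuple0 (R : nmodType) (T : finType) (F : seq T -> R) :
  \sum_(s : 0.-tuple T) F s = F [::].
Proof.
rewrite (bigD1 [tuple]) //= big1 ?addr0 // => s.
by move/eqP; case; rewrite [s]tuple0; apply: val_inj.
Qed.

Lemma big_pair_fin (V : nmodType) (A B : finType) (G : A * B -> V) :
  \sum_x G x = \sum_a \sum_b G (a, b).
Proof. by rewrite pair_bigA; apply: eq_bigr => -[]. Qed.

Lemma big_triple (V : nmodType) (A B C : finType) (G : A * B * C -> V) :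
  \sum_x G x = \sum_a \sum_b \sum_c G (a, b, c).
Proof. by rewrite !pair_bigA; apply: eq_bigr => -[[a b] c]. Qed.

Section History.
Context {n : nat} {S : finType}.
Implicit Types (st : seq (step n S)).
Definition acts st := [seq s.1.1 | s <- st].
Definition cfgs st := [seq s.1.2 | s <- st].
Definition obss st := [seq s.2 | s <- st].
End History.

Section Jw.
Variables (R : realType) (n : nat) (S W : finType).
Variables (f : S -> Mn n S -> W -> S) (pw : {ffun 'I_n -> W} -> R) (q : R).
Variable g : strategy n S.

Lemma jw_rcons c os0 as0 (st : seq (step n S)) a c' o' :
  jw f pw q g c os0 as0 (rcons st (a, c', o')) =
  jw f pw q g c os0 as0 st *
   ((a == g (os0 ++ obss st) (as0 ++ acts st))%:R *
    Ts f pw c' (last c (cfgs st)) * obsP q a (emp c') o').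
Proof.
elim: st c os0 as0 => [|[[b d] o] st IH] c os0 as0 /=.
  by rewrite !cats0 mulr1 mul1r.
by rewrite IH -!cats1 -!catA !mulrA.
Qed.

Lemma zip3_steps (as_ : seq bool) (cs : seq (Cfg n S)) (os : seq (obs n S)) t :
  size as_ = t -> size cs = t -> size os = t ->
  [/\ acts (zip (zip as_ cs) os) = as_, cfgs (zip (zip as_ cs) os) = cs &
      obss (zip (zip as_ cs) os) = os].
Proof.
elim: t as_ cs os => [|t IH] [|a as_] [|c cs] [|o os] //= [h1] [h2] [h3].
by have [-> -> ->] := IH _ _ _ h1 h2 h3.
Qed.

(** Separating the components lets the configurations be summed out while the agent's information,
    actions and observations, stays fixed. *)
Lemma big_steps (V : nmodType) t (F : seq (step n S) -> V) :
  \sum_(st : t.-tuple (step n S)) F st =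
  \sum_(as_ : t.-tuple bool) \sum_(os : t.-tuple (obs n S))
   \sum_(cs : t.-tuple (Cfg n S)) F (zip (zip as_ cs) os).
Proof.
elim: t F => [|t IH] F.
  rewrite big_tuple0.
  rewrite (big_tuple0 (fun as_ => \sum_(os : 0.-tuple (obs n S))
     \sum_(cs : 0.-tuple (Cfg n S)) F (zip (zip as_ cs) os))).
  rewrite (big_tuple0 (fun os =>
     \sum_(cs : 0.-tuple (Cfg n S)) F (zip (zip [::] cs) os))).
  by rewrite (big_tuple0 (fun cs => F (zip (zip [::] cs) [::]))).
rewrite big_tuple_cons.
rewrite (big_tuple_cons _ (fun as_ => \sum_(os : t.+1.-tuple (obs n S))
     \sum_(cs : t.+1.-tuple (Cfg n S)) F (zip (zip as_ cs) os))).
under [LHS]eq_bigr => x _ do rewrite (IH (fun s => F (x :: s))).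
have E (a : bool) (as_ : seq bool) : \sum_(os : t.+1.-tuple (obs n S))
     \sum_(cs : t.+1.-tuple (Cfg n S)) F (zip (zip (a :: as_) cs) os) =
   \sum_o \sum_c \sum_(os : t.-tuple (obs n S))
     \sum_(cs : t.-tuple (Cfg n S)) F ((a, c, o) :: zip (zip as_ cs) os).
  rewrite (big_tuple_cons _ (fun os => \sum_(cs : t.+1.-tuple (Cfg n S))
    F (zip (zip (a :: as_) cs) os))).
  apply: eq_bigr => o _; rewrite [RHS]exchange_big /=; apply: eq_bigr => os _.
  by rewrite (big_tuple_cons _ (fun cs => F (zip (zip (a :: as_) cs) (o :: os)))).
under [RHS]eq_bigr => a _ do under eq_bigr => as_ _ do rewrite E.
rewrite big_triple.
apply: eq_bigr => a _.
rewrite [LHS]exchange_big [RHS]exchange_big; apply: eq_bigr => o _.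
exact: exchange_big.
Qed.

End Jw.

Section ChainObs.
Variables (R : realType) (M : finType) (T : M -> M -> R) (q : R).
Hypothesis T_sum : forall m, \sum_m' T m' m = 1.

Lemma Tpow_step x y (F : M -> R) :
  \sum_m Tpow T y m x * (\sum_m' T m' m * F m') = \sum_m' Tpow T y.+1 m' x * F m'.
Proof.
under eq_bigr do rewrite mulr_sumr.
rewrite exchange_big /=; apply: eq_bigr => m' _; rewrite mulr_suml.
by apply: eq_bigr => m _; rewrite mulrA (mulrC (Tpow _ _ _ _)).
Qed.

(** One unnormalised Bayes update. A blank has the same likelihood for every [m'], so the predicted
    law [Tpow T y.+1] is kept and only the age grows; an observed [m0] concentrates the law there
    with age 0. The condition on [o] excludes the reset to [mstar], which is not a Bayes update. *)
Lemma Tpow_obsP k (mstar : M) x (y : 'I_k.+1) a o (F : M -> R) :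
  (o = None -> (y < k)%N) ->
  \sum_m' Tpow T y.+1 m' x * (obsP q a m' o * F m') =
  Pobs q T x y a o *
    \sum_m Tpow T (ftilde mstar (x, y) o).2 m (ftilde mstar (x, y) o).1 * F m.
Proof.
case: o => [m0 _|/(_ erefl) yk]; last first.
  rewrite /ftilde /= yk /= inordK // /Pobs eqxx !mulr1 mulr0 addr0 mulr_sumr.
  apply: eq_bigr => m' _; rewrite /obsP /=.
  by case: a => /=; ring.
rewrite /Pobs; move: (Tpow T y.+1) => P0; rewrite /ftilde /= mulr0 add0r.
rewrite (bigD1 m0) //= big1 ?addr0; last first.
  move=> m' /negbTE m'0; rewrite /obsP; case: a => /=; last by rewrite mul0r mulr0.
  by rewrite -[Some m0 == _]/(m0 == m') eq_sym m'0 !mulr0 addr0 mul0r mulr0.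
rewrite [in RHS](bigD1 m0) //= eqxx mul1r big1 ?addr0; last first.
  by move=> m' /negbTE ->; rewrite mul0r.
by rewrite /obsP; case: a => /=; rewrite ?eqxx /=; ring.
Qed.

Lemma Tpow_obsP1 x (y : nat) a o :
  \sum_m' Tpow T y.+1 m' x * obsP q a m' o = Pobs q T x y a o.
Proof.
(* Taking [y.+1] as the horizon makes the age condition automatic. *)
have := @Tpow_obsP y.+1 x x (inord y) a o (fun=> 1).
rewrite inordK; last exact: leqW.
move=> /(_ (fun _ => leqnn _)).
under eq_bigr do rewrite mulr1.
move=> ->; under eq_bigr do rewrite mulr1.
by rewrite Tpow_sum ?mulr1.
Qed.

End ChainObs.

Section Filter.
Variables (R : realType) (n : nat) (S W : finType).
Variables (f : S -> Mn n S -> W -> S) (pw : {ffun 'I_n -> W} -> R).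
Variables (p0 : Cfg n S -> R) (q : R).
Hypothesis pw_ge0 : forall w, 0 <= pw w.
Hypothesis pw_sum : \sum_(w : {ffun 'I_n -> W}) pw w = 1.
Hypothesis pw_exch : forall (sigma : 'S_n) (w : {ffun 'I_n -> W}),
      pw [ffun i => w (sigma i)] = pw w.
Hypothesis p0_ge0 : forall c, 0 <= p0 c.
Hypothesis p0_sum : \sum_(c : Cfg n S) p0 c = 1.
Hypothesis q01 : 0 <= q <= 1.
Variables (k : nat) (mstar : Mn n S) (g : strategy n S).

Let T := Tm f pw.
Let T_sum : forall m, \sum_m' T m' m = 1 := Tm_sum f pw_sum pw_exch.
Notation trk o1 os := (track k mstar (o1 :: os)).

(* Sum of F over the current configuration, on the event that the observations are o1 :: os and
   the actions as_; with F = 1 it is the probability of that event. *)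
Definition condE t (o1 : obs n S) os as_ (F : Cfg n S -> R) : R :=
  \sum_(c1 : Cfg n S) \sum_(cs : t.-tuple (Cfg n S))
    Defs.pathP f pw p0 q g c1 o1 (zip (zip as_ cs) os) * F (last c1 cs).

Lemma condE_rcons t o1 os as_ o a F : size os = t -> size as_ = t ->
  condE t.+1 o1 (rcons os o) (rcons as_ a) F =
  (a == g (o1 :: os) as_)%:R *
    condE t o1 os as_ (fun c => \sum_c' Ts f pw c' c * (obsP q a (emp c') o * F c')).
Proof.
move=> so sa; rewrite /condE mulr_sumr; apply: eq_bigr => c1 _.
rewrite (big_tuple_rcons _ (fun cs : seq (Cfg n S) =>
  Defs.pathP f pw p0 q g c1 o1 (zip (zip (rcons as_ a) cs) (rcons os o)) * F (last c1 cs))).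
rewrite mulr_sumr; apply: eq_bigr => cs _.
rewrite !mulr_sumr; apply: eq_bigr => c _.
rewrite last_rcons /Defs.pathP !zip_rcons ?size_zip ?size_tuple ?sa ?so ?minnn //.
have [ea ec eo] := zip3_steps sa (size_tuple cs) so.
by rewrite jw_rcons ea ec eo /=; ring.
Qed.

Lemma track_rcons o1 os o : trk o1 (rcons os o) = ftilde mstar (trk o1 os) o.
Proof. by rewrite /track /= -cats1 foldl_cat. Qed.

(** The age is still below [k] when an update at a time below [k] is due, which excludes the
    reset. *)
Lemma track_le o1 os : ((trk o1 os).2 <= size os)%N.
Proof.
elim/last_ind: os => [|os o IH]; first by [].
rewrite track_rcons size_rcons; case: o => [m|] //=.
case: (trk o1 os) IH => x y /= IH; case: ifP => //= yk.
by rewrite inordK ?ltnS.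
Qed.

Lemma eq_condE t o1 os as_ F G : F =1 G -> condE t o1 os as_ F = condE t o1 os as_ G.
Proof.
by move=> e; apply: eq_bigr => c _; apply: eq_bigr => cs _; rewrite e.
Qed.

(* As long as t <= k the tracker has never been reset to mstar, hence it is a sufficient statistic. *)
Lemma condE_filter t o1 os as_ (F : Mn n S -> R) : size os = t -> size as_ = t ->
  (t <= k)%N ->
  condE t o1 os as_ (fun c => F (emp c)) =
  condE t o1 os as_ (fun=> 1) *
    \sum_m Tpow T (trk o1 os).2 m (trk o1 os).1 * F m.
Proof.
elim/last_ind: os t as_ F => [|os o IH] t as_ F.
  move=> <- /eqP; rewrite size_eq0 => /eqP -> _; rewrite /condE mulr_suml.
  apply: eq_bigr => c1 _.
  rewrite (big_tuple0 (fun cs : seq (Cfg n S) =>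
    Defs.pathP f pw p0 q g c1 o1 (zip (zip [::] cs) [::]) * F (emp (last c1 cs)))).
  rewrite (big_tuple0 (fun cs : seq (Cfg n S) =>
    Defs.pathP f pw p0 q g c1 o1 (zip (zip [::] cs) [::]) * 1)) /=.
  (* The initial observation is the true type, matching the indicator [Tpow T 0]; an initial blank
     has weight 0. *)
  rewrite /Defs.pathP /= /track /=; case: o1 => [m1|]; last by rewrite !(mulr0,mul0r).
  rewrite -[Some m1 == _]/(m1 == emp c1); have [->|] := eqVneq m1 (emp c1); last by rewrite !(mulr0,mul0r).
  rewrite (bigD1 (emp c1)) //= eqxx big1 ?addr0 ?mul1r ?mulr1 // => m /negbTE ->.
  by rewrite mul0r.
case/lastP: as_ => [|as_ a]; first by rewrite size_rcons => <-.
rewrite !size_rcons; case: t => // t [so] [sa] tk.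
rewrite !condE_rcons //.
have step (G : Mn n S -> R) :
    condE t o1 os as_ (fun c => \sum_c' Ts f pw c' c * (obsP q a (emp c') o * G (emp c')))
  = condE t o1 os as_ (fun=> 1) * (\sum_m' Tpow T (trk o1 os).2.+1 m' (trk o1 os).1 *
       (obsP q a m' o * G m')).
  rewrite (@eq_condE _ _ _ _ _ (fun c =>
     \sum_m T m (emp c) * (obsP q a m o * G m))); last first.
    by move=> c; exact: (Ts_emp f pw_exch (fun m => obsP q a m o * G m)).
  by rewrite (IH t as_ (fun m0 => \sum_m T m m0 * (obsP q a m o * G m))) ?(ltnW tk) // Tpow_step.
rewrite (step F) (step (fun=> 1)).
have := track_le o1 os; rewrite so track_rcons.
case: (trk o1 os) => x y /= yt.
rewrite (@Tpow_obsP _ _ _ _ _ mstar); last by move=> _; exact: leq_ltn_trans tk.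
under [X in _ = _ * (_ * X) * _]eq_bigr do rewrite mulr1.
by rewrite (Tpow_obsP1 q T_sum x y a o); ring.
Qed.

Lemma condE1_rcons t o1 os as_ o a : size os = t -> size as_ = t -> (t <= k)%N ->
  condE t.+1 o1 (rcons os o) (rcons as_ a) (fun=> 1) =
  (a == g (o1 :: os) as_)%:R * (condE t o1 os as_ (fun=> 1) *
    Pobs q T (trk o1 os).1 (trk o1 os).2 a o).
Proof.
move=> so sa tk; rewrite condE_rcons //; congr (_ * _).
rewrite (@eq_condE _ _ _ _ _ (fun c => \sum_m T m (emp c) * (obsP q a m o * 1))); last first.
  by move=> c; exact: (Ts_emp f pw_exch (fun m => obsP q a m o * 1)).
rewrite (@condE_filter _ _ _ _ (fun m0 => \sum_m T m m0 * (obsP q a m o * 1))) //.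
rewrite Tpow_step.
by under eq_bigr do rewrite mulr1; rewrite Tpow_obsP1.
Qed.

(** Normalising cancels the weight of the history. On a null history [belief] divides by 0, but such
    a history contributes nothing to [Ecost]. *)
Lemma beliefE t o1 os as_ : size os = t -> size as_ = t -> (t <= k)%N ->
  condE t o1 os as_ (fun=> 1) != 0 ->
  belief f pw p0 q g (o1 :: os) as_ =
  fun m => Tpow T (trk o1 os).2 m (trk o1 os).1.
Proof.
move=> so sa tk Z0; apply/funext => m.
have J m' : jointM f pw p0 q g (o1 :: os) as_ m' =
   condE t o1 os as_ (fun=> 1) * Tpow T (trk o1 os).2 m' (trk o1 os).1.
  have -> : jointM f pw p0 q g (o1 :: os) as_ m' =
    condE (size as_) o1 os as_ (fun c => (emp c == m')%:R) by [].
  rewrite sa (@condE_filter _ _ _ _ (fun m => (m == m')%:R)) //; congr (_ * _).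
  rewrite (bigD1 m') //= eqxx mulr1 big1 ?addr0 // => z /negbTE ->.
  by rewrite mulr0.
rewrite /belief J; under eq_bigr do rewrite J.
by rewrite -mulr_sumr Tpow_sum // mulr1 mulrC mulKf.
Qed.

Section Cost.
Variables (E : Type) (cost : Mn n S -> E -> bool -> R) (h : (Mn n S -> R) -> E).

Lemma EcostE t : Ecost f pw p0 q cost h g t =
  \sum_(as_ : t.-tuple bool) \sum_(os : t.-tuple (obs n S)) \sum_o1
    condE t o1 os as_ (fun c => cost (emp c) (h (belief f pw p0 q g (o1 :: os) as_))
      (g (o1 :: os) as_)).
Proof.
rewrite /Ecost.
under eq_bigr => c1 _ do under eq_bigr => o1 _ do
  rewrite (big_steps _ (fun st : seq (step n S) => Defs.pathP f pw p0 q g c1 o1 st *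
    (cost (emp (last c1 [seq s.1.2 | s <- st]))
          (h (belief f pw p0 q g (o1 :: [seq s.2 | s <- st]) [seq s.1.1 | s <- st]))
          (g (o1 :: [seq s.2 | s <- st]) [seq s.1.1 | s <- st])))).
transitivity (\sum_(c1 : Cfg n S) \sum_(as_ : t.-tuple bool)
  \sum_(os : t.-tuple (obs n S)) \sum_(o1 : obs n S) \sum_(cs : t.-tuple (Cfg n S))
    Defs.pathP f pw p0 q g c1 o1 (zip (zip as_ cs) os) *
    cost (emp (last c1 cs)) (h (belief f pw p0 q g (o1 :: os) as_))
      (g (o1 :: os) as_)).
  apply: eq_bigr => c1 _; rewrite exchange_big; apply: eq_bigr => as_ _.
  rewrite exchange_big; apply: eq_bigr => os _; apply: eq_bigr => o1 _.
  apply: eq_bigr => cs _.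
  have [] := zip3_steps (size_tuple as_) (size_tuple cs) (size_tuple os).
  by rewrite /acts /cfgs /obss => -> -> ->.
rewrite exchange_big; apply: eq_bigr => as_ _.
rewrite exchange_big; apply: eq_bigr => os _.
by rewrite exchange_big.
Qed.

Lemma Ecost_chat t : (t <= k)%N -> Ecost f pw p0 q cost h g t =
  \sum_(as_ : t.-tuple bool) \sum_(os : t.-tuple (obs n S)) \sum_o1
    condE t o1 os as_ (fun=> 1) *
    chat T cost h (trk o1 os).1 (trk o1 os).2 (g (o1 :: os) as_).
Proof.
move=> tk; rewrite EcostE.
apply: eq_bigr => as_ _; apply: eq_bigr => os _; apply: eq_bigr => o1 _.
rewrite (@condE_filter _ _ _ _ (fun m => cost m (h (belief f pw p0 q g (o1 :: os) as_))
      (g (o1 :: os) as_))) ?size_tuple //.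
have [->|Z0] := eqVneq (condE t o1 os as_ (fun=> 1)) 0; first by rewrite !mul0r.
rewrite (beliefE _ _ tk Z0) ?size_tuple //; congr (_ * _).
by apply: eq_bigr => m _; rewrite mulrC.
Qed.

Definition valueE t (V : Mn n S * 'I_k.+1 -> R) :=
  \sum_(as_ : t.-tuple bool) \sum_(os : t.-tuple (obs n S)) \sum_o1
    condE t o1 os as_ (fun=> 1) * V (trk o1 os).

(** Only the law of the next observation given the history up to index [t] enters, and the filter
    provides it for [t = k] too. A reset in that step does no harm, since [V] is evaluated at
    whatever [ftilde] returns; hence [k.+1] Bellman steps rather than [k]. *)
Lemma valueE_step t V : (t <= k)%N -> valueE t.+1 V =
  \sum_(as_ : t.-tuple bool) \sum_(os : t.-tuple (obs n S)) \sum_o1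
    condE t o1 os as_ (fun=> 1) *
    \sum_o Pobs q T (trk o1 os).1 (trk o1 os).2 (g (o1 :: os) as_) o
      * V (ftilde mstar (trk o1 os) o).
Proof.
move=> tk; rewrite /valueE.
rewrite (big_tuple_rcons _ (fun as_ : seq bool =>
  \sum_(os : t.+1.-tuple (obs n S)) \sum_o1
    condE t.+1 o1 os as_ (fun=> 1) * V (trk o1 os))).
apply: eq_bigr => as_ _.
under eq_bigr => a _ do rewrite (big_tuple_rcons _ (fun os : seq (obs n S) => \sum_o1
    condE t.+1 o1 os (rcons as_ a) (fun=> 1) * V (trk o1 os))).
rewrite exchange_big; apply: eq_bigr => os _ /=.
under eq_bigr do rewrite exchange_big /=.
rewrite exchange_big; apply: eq_bigr => o1 _ /=.
rewrite exchange_big mulr_sumr; apply: eq_bigr => o _ /=.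
rewrite (bigD1 (g (o1 :: os) as_)) //= big1 ?addr0.
  by rewrite condE1_rcons ?size_tuple // eqxx mul1r track_rcons mulrA.
move=> a /negbTE ag.
by rewrite condE1_rcons ?size_tuple // ag !mul0r.
Qed.

End Cost.

Lemma jw_ge0 c os as_ st : 0 <= jw f pw q g c os as_ st.
Proof.
elim: st c os as_ => [|[[a c'] o'] st IH] c os as_ //=.
by rewrite !mulr_ge0 // ?Ts_ge0 ?obsP_ge0.
Qed.

Lemma pathP_ge0 c1 o1 st : 0 <= Defs.pathP f pw p0 q g c1 o1 st.
Proof. by rewrite /Defs.pathP !mulr_ge0 ?jw_ge0. Qed.

Lemma Ts_sum c : \sum_c' Ts f pw c' c = 1.
Proof.
transitivity (\sum_c' Ts f pw c' c * (fun=> 1) (emp c')).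
  by apply: eq_bigr => c' _; rewrite mulr1.
rewrite (Ts_emp f pw_exch (fun=> 1)) -[RHS](T_sum (emp c)).
by apply: eq_bigr => m _; rewrite mulr1.
Qed.

Lemma pathP_sum t : \sum_(c1 : Cfg n S) \sum_(o1 : obs n S)
  \sum_(st : t.-tuple (step n S)) Defs.pathP f pw p0 q g c1 o1 st = 1.
Proof.
transitivity (\sum_(c1 : Cfg n S) p0 c1 * 1); last first.
  by under eq_bigr do rewrite mulr1.
apply: eq_bigr => c1 _; rewrite /Defs.pathP.
under eq_bigr do rewrite -mulr_sumr -mulrA.
rewrite -mulr_sumr; congr (_ * _).
rewrite (bigD1 (Some (emp c1))) //= eqxx mul1r [X in _ + X]big1 ?addr0; last first.
  by move=> o /negbTE ->; rewrite mul0r.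
elim: t => [|t IH]; first by rewrite (big_tuple0 (jw f pw q g c1 _ _)).
rewrite (big_tuple_rcons _ (jw f pw q g c1 _ _)) -[RHS]IH.
apply: eq_bigr => st _; rewrite big_triple.
under eq_bigr => a _ do under eq_bigr => c _ do under eq_bigr => o _ do rewrite jw_rcons.
under eq_bigr => a _ do under eq_bigr => c _ do rewrite -!mulr_sumr obsP_sum // mulr1.
under eq_bigr do rewrite -!mulr_sumr Ts_sum mulr1.
by rewrite -mulr_sumr (bigD1 (g ([:: Some (emp c1)] ++ obss st) ([::] ++ acts st))) //= eqxx big1
  ?addr0 ?mulr1 // => a /negbTE ->.
Qed.

End Filter.

(** * Near-optimality of greedy strategies *)

Lemma sum_weighted_bounds (R : realFieldType) (I : finType) (p F : I -> R) b :
  (forall i, 0 <= p i) -> \sum_i p i = 1 -> (forall i, 0 <= F i <= b) ->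
  0 <= \sum_i p i * F i <= b.
Proof.
move=> p0 p1 F0b; apply/andP; split.
  by apply: sumr_ge0 => i _; rewrite mulr_ge0 //; case/andP: (F0b i).
rewrite -[b]mul1r -p1 mulr_suml; apply: ler_sum => i _.
by rewrite ler_wpM2l //; case/andP: (F0b i).
Qed.

Definition qmin (R : realDomainType) (M : finType) (k : nat)
  (Q : M -> 'I_k.+1 -> bool -> R) (z : M * 'I_k.+1) : R :=
  Num.min (Q z.1 z.2 false) (Q z.1 z.2 true).

Section BellmanBounds.
Variables (R : realType) (M : finType) (E : Type) (T : M -> M -> R) (q gamma : R).
Variables (cost : M -> E -> bool -> R) (h : (M -> R) -> E) (cmax : R).
Hypothesis T_ge0 : forall m' m, 0 <= T m' m.
Hypothesis T_sum : forall m, \sum_m' T m' m = 1.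
Hypothesis q01 : 0 <= q <= 1.
Hypothesis gamma01 : 0 < gamma < 1.
Hypothesis cost_ge0 : forall m mh a, 0 <= cost m mh a.
Hypothesis cost_le : forall m mh a, cost m mh a <= cmax.

Lemma chat_bounds x y a : 0 <= chat T cost h x y a <= cmax.
Proof.
rewrite /chat; under eq_bigr do rewrite mulrC.
apply: sum_weighted_bounds => [m||m]; first exact: Tpow_ge0.
  exact: Tpow_sum.
by rewrite cost_ge0 cost_le.
Qed.

Variables (k : nat) (mstar : M) (Q : M -> 'I_k.+1 -> bool -> R).
Hypothesis QE : Bellman mstar q gamma T cost h Q.

Lemma QstarE x y a : Q x y a = chat T cost h x y a +
  gamma * \sum_o Pobs q T x y a o * qmin Q (ftilde mstar (x, y) o).
Proof. exact: QE. Qed.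

(** The equation is read at a minimiser and at a maximiser of [Q]: the minimum is at least gamma
    times itself, the maximum at most [cmax] plus gamma times itself. *)
Lemma Bellman_bounds x y a : 0 <= Q x y a <= cmax / (1 - gamma).
Proof.
case/andP: gamma01 => g0 g1.
pose F (z : M * 'I_k.+1 * bool) := Q z.1.1 z.1.2 z.2.
pose lo := [arg min_(z < (x, y, a)) F z]%O.
pose hi := [arg max_(z > (x, y, a)) F z]%O.
have loP z : F lo <= F z by rewrite /lo; case: Order.TotalTheory.arg_minP => // i _; exact.
have hiP z : F z <= F hi by rewrite /hi; case: Order.TotalTheory.arg_maxP => // i _; exact.
(* Shifting by the minimum gives the non-negative values that [sum_weighted_bounds] demands, before
   the sign of the minimum is known. *)
have qminP z : 0 <= qmin Q z - F lo <= F hi - F lo.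
  rewrite subr_ge0 lerB ?le_min ?ge_min ?(loP (z, _)) //=.
  by rewrite (hiP (z, false)).
have bnd (z : M * 'I_k.+1 * bool) : 0 <= \sum_o Pobs q T z.1.1 z.1.2 z.2 o *
     (qmin Q (ftilde mstar z.1 o) - F lo) <= F hi - F lo.
  apply: sum_weighted_bounds => [i||i]; [exact: Pobs_ge0|exact: Pobs_sum|by []].
have FE z : F z = chat T cost h z.1.1 z.1.2 z.2 + gamma * F lo + gamma *
   \sum_o Pobs q T z.1.1 z.1.2 z.2 o * (qmin Q (ftilde mstar z.1 o) - F lo).
  rewrite {1}/F QstarE; case: z => [[x1 y1] a1] /=.
  under [in RHS]eq_bigr do rewrite mulrBr.
  rewrite big_split /= sumrN -mulr_suml Pobs_sum // mul1r.
  by rewrite mulrBr -addrA addrCA addrC; ring.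
have lo0 : 0 <= F lo.
  have /andP[c0 _] := chat_bounds lo.1.1 lo.1.2 lo.2.
  have /andP[s0 _] := bnd lo.
  have : gamma * F lo <= F lo by rewrite {2}FE; nra.
  by nra.
have hi1 : F hi <= cmax / (1 - gamma).
  have /andP[_ c0] := chat_bounds hi.1.1 hi.1.2 hi.2.
  have /andP[_ s0] := bnd hi.
  rewrite ler_pdivlMr ?subr_gt0 //.
  have : F hi <= cmax + gamma * F hi.
    rewrite {1}FE.
    have : gamma * \sum_o Pobs q T hi.1.1 hi.1.2 hi.2 o *
     (qmin Q (ftilde mstar hi.1 o) - F lo) <= gamma * (F hi - F lo).
      by rewrite ler_wpM2l // ltW.
    lra.
  lra.
by rewrite (le_trans lo0 (loP (x, y, a))) (le_trans (hiP (x, y, a)) hi1).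
Qed.

Lemma qmin_bounds z : 0 <= qmin Q z <= cmax / (1 - gamma).
Proof.
have /andP[a1 a2] := Bellman_bounds z.1 z.2 false.
have /andP[b1 b2] := Bellman_bounds z.1 z.2 true.
by rewrite /qmin le_min ge_min a1 b1 a2.
Qed.

End BellmanBounds.

Section DiscountedSeries.
Variables (R : realType) (gamma b : R) (u : nat -> R).
Hypothesis gamma01 : 0 < gamma < 1.
Hypothesis ub : forall t, 0 <= u t <= b.
Let s N := \sum_(t < N) gamma ^+ t * u t.

(** The partial sum plus the worst-case remainder never increases: [b / (1 - gamma)] solves v = b +
    gamma v, and each new term uses at most its share [b]. *)
Lemma discounted_tail N j :
  s (N + j)%N + gamma ^+ (N + j) * (b / (1 - gamma)) <= s N + gamma ^+ N * (b / (1 - gamma)).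
Proof.
case/andP: gamma01 => g0 g1.
elim: j => [|j IH]; first by rewrite addn0.
apply: le_trans IH; rewrite addnS /s big_ord_recr /= -addrA lerD2l exprSr.
have -> : gamma ^+ (N + j) * (b / (1 - gamma)) = gamma ^+ (N + j) * b +
   gamma ^+ (N + j) * gamma * (b / (1 - gamma)).
  by field; rewrite gt_eqF // subr_gt0.
rewrite lerD2r ler_wpM2l ?exprn_ge0 ?(ltW g0) //.
by case/andP: (ub (N + j)).
Qed.

Lemma discounted_limn_bounds N :
  s N <= limn s <= s N + gamma ^+ N * (b / (1 - gamma)).
Proof.
case/andP: gamma01 => g0 g1.
have b0 : 0 <= b by case/andP: (ub 0%N); exact: le_trans.
have nd : nondecreasing_seq s.
  apply/nondecreasing_seqP => j; rewrite /s big_ord_recr /= lerDl.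
  by rewrite mulr_ge0 ?exprn_ge0 ?(ltW g0) //; case/andP: (ub j).
have bd j : s j <= s N + gamma ^+ N * (b / (1 - gamma)).
  apply: le_trans (discounted_tail N j).
  apply: (le_trans (nd _ _ (leq_addl N j))).
  by rewrite lerDl mulr_ge0 ?exprn_ge0 ?(ltW g0) // divr_ge0 // subr_ge0 ltW.
(* [limn] carries information only once convergence is known. *)
have cv : cvgn s.
  apply: nondecreasing_is_cvgn => //.
  by exists (s N + gamma ^+ N * (b / (1 - gamma))) => _ [j _ <-]; exact: bd.
rewrite nondecreasing_cvgn_le //=.
by apply: limr_le => //; near=> j; exact: bd.
Unshelve. all: by end_near. Qed.

End DiscountedSeries.

Section PartB.
Variables (R : realType) (n : nat) (S W : finType) (E : Type).
Variables (f : S -> Mn n S -> W -> S) (pw : {ffun 'I_n -> W} -> R).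
Variables (p0 : Cfg n S -> R) (q gamma : R).
Variables (cost : Mn n S -> E -> bool -> R) (h : (Mn n S -> R) -> E) (cmax : R).
Hypothesis pw_ge0 : forall w, 0 <= pw w.
Hypothesis pw_sum : \sum_(w : {ffun 'I_n -> W}) pw w = 1.
Hypothesis pw_exch : forall (sigma : 'S_n) (w : {ffun 'I_n -> W}),
      pw [ffun i => w (sigma i)] = pw w.
Hypothesis p0_ge0 : forall c, 0 <= p0 c.
Hypothesis p0_sum : \sum_(c : Cfg n S) p0 c = 1.
Hypothesis q01 : 0 <= q <= 1.
Hypothesis gamma01 : 0 < gamma < 1.
Hypothesis cost_ge0 : forall m mh a, 0 <= cost m mh a.
Hypothesis cost_le : forall m mh a, cost m mh a <= cmax.
Variables (k : nat) (mstar : Mn n S) (Q : Mn n S -> 'I_k.+1 -> bool -> R).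
Hypothesis QE : Bellman mstar q gamma (Tm f pw) cost h Q.

Notation trk o1 os := (track k mstar (o1 :: os)).

Let T_ge0 := Tm_ge0 f pw_ge0.
Let T_sum := Tm_sum f pw_sum pw_exch.

Lemma Ecost_bounds g t : 0 <= Ecost f pw p0 q cost h g t <= cmax.
Proof.
have := pathP_sum f q pw_sum pw_exch p0_sum g t.
rewrite /Ecost => P1; apply/andP; split.
  do 3![apply: sumr_ge0 => ? _]; rewrite mulr_ge0 //.
  exact: pathP_ge0.
rewrite -[leRHS]mul1r -P1 mulr_suml; apply: ler_sum => c1 _.
rewrite mulr_suml; apply: ler_sum => o1 _.
rewrite mulr_suml; apply: ler_sum => st _.
by rewrite ler_wpM2l // pathP_ge0.
Qed.

Lemma condE1_ge0 g t o1 os as_ : 0 <= condE f pw p0 q g t o1 os as_ (fun=> 1).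
Proof. by do 2![apply: sumr_ge0 => ? _]; rewrite mulr1 pathP_ge0. Qed.

Lemma condE1_sum g t : \sum_(as_ : t.-tuple bool) \sum_(os : t.-tuple (obs n S)) \sum_o1
    condE f pw p0 q g t o1 os as_ (fun=> 1) = 1.
Proof.
(* The total mass is the expectation of the constant cost 1, with [unit] as the type of estimates,
   so [EcostE] does the resummation. *)
rewrite -(EcostE f pw p0 q g (fun _ (_ : unit) _ => 1) (fun=> tt)).
rewrite -[RHS](pathP_sum f q pw_sum pw_exch p0_sum g t).
by do 3![apply: eq_bigr => ? _]; rewrite mulr1.
Qed.

Lemma valueE_bounds g t : 0 <= valueE f pw p0 q mstar g t (qmin Q) <= cmax / (1 - gamma).
Proof.
have B := qmin_bounds T_ge0 T_sum q01 gamma01 cost_ge0 cost_le QE.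
apply/andP; split.
  apply: sumr_ge0 => as_ _; apply: sumr_ge0 => os _; apply: sumr_ge0 => o1 _.
  by rewrite mulr_ge0 ?condE1_ge0 //; case/andP: (B (trk o1 os)).
rewrite -[leRHS]mul1r -[X in X * _](condE1_sum g t) mulr_suml; apply: ler_sum => as_ _.
rewrite mulr_suml; apply: ler_sum => os _.
rewrite mulr_suml; apply: ler_sum => o1 _.
by rewrite ler_wpM2l ?condE1_ge0 //; case/andP: (B (trk o1 os)).
Qed.

(** No decision precedes index 0, so this value is the common reference for the costs of two
    different strategies. *)
Lemma valueE0 g g' : valueE f pw p0 q mstar g 0 (qmin Q) = valueE f pw p0 q mstar g' 0 (qmin Q).
Proof.
apply: eq_bigr => as_ _; apply: eq_bigr => os _; apply: eq_bigr => o1 _.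
congr (_ * _); apply: eq_bigr => c1 _; apply: eq_bigr => cs _.
by rewrite (tuple0 as_) (tuple0 os) (tuple0 cs).
Qed.

Lemma cost_valueE_step g t : (t <= k)%N ->
  Ecost f pw p0 q cost h g t + gamma * valueE f pw p0 q mstar g t.+1 (qmin Q) =
  \sum_(as_ : t.-tuple bool) \sum_(os : t.-tuple (obs n S)) \sum_o1
    condE f pw p0 q g t o1 os as_ (fun=> 1) *
    Q (trk o1 os).1 (trk o1 os).2 (g (o1 :: os) as_).
Proof.
move=> tk; rewrite (Ecost_chat f p0 q pw_sum pw_exch mstar g cost h tk) // valueE_step //.
rewrite mulr_sumr -big_split; apply: eq_bigr => as_ _ /=.
rewrite mulr_sumr -big_split; apply: eq_bigr => os _ /=.
rewrite mulr_sumr -big_split; apply: eq_bigr => o1 _ /=.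
by rewrite (QstarE QE) mulrDr mulrCA -surjective_pairing.
Qed.

Lemma valueE_le_step g t : (t <= k)%N ->
  valueE f pw p0 q mstar g t (qmin Q) <=
  Ecost f pw p0 q cost h g t + gamma * valueE f pw p0 q mstar g t.+1 (qmin Q).
Proof.
move=> tk; rewrite cost_valueE_step //.
do 3![apply: ler_sum => ? _]; rewrite ler_wpM2l ?condE1_ge0 // /qmin ge_min.
by case: (g _ _); rewrite lexx ?orbT.
Qed.

Lemma valueE_greedy_step gs t : (t <= k)%N ->
  (forall x y a, Q x y (gs x y) <= Q x y a) ->
  let g := greedy_strategy mstar gs in
  valueE f pw p0 q mstar g t (qmin Q) =
  Ecost f pw p0 q cost h g t + gamma * valueE f pw p0 q mstar g t.+1 (qmin Q).
Proof.
move=> tk opt g; rewrite cost_valueE_step //.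
do 3![apply: eq_bigr => ? _]; congr (_ * _); rewrite /qmin /g /greedy_strategy.
apply/eqP; rewrite eq_le le_min !opt /= ge_min.
by case: (gs _ _); rewrite lexx ?orbT.
Qed.

(** Non-negative costs make the truncated sum a lower bound of [Jcost]; the loss is the value left
    after [k.+1] steps. *)
Lemma ge_Jcost g : valueE f pw p0 q mstar g 0 (qmin Q) <=
  Jcost f pw p0 q gamma cost h g + gamma ^+ k.+1 * (cmax / (1 - gamma)).
Proof.
case/andP: (gamma01) => g0 _.
have [/andP[J1 _]] := discounted_limn_bounds gamma01 (Ecost_bounds g) k.+1.
have tel N : (N <= k.+1)%N -> valueE f pw p0 q mstar g 0 (qmin Q) <=
    \sum_(t < N) gamma ^+ t * Ecost f pw p0 q cost h g t
     + gamma ^+ N * valueE f pw p0 q mstar g N (qmin Q).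
  elim: N => [|N IH] Nk; first by rewrite big_ord0 add0r mul1r.
  apply: (le_trans (IH (ltnW Nk))); rewrite big_ord_recr /= -addrA lerD2l.
  by rewrite exprSr -mulrA -mulrDr ler_wpM2l ?exprn_ge0 ?(ltW g0) ?valueE_le_step.
apply: (le_trans (tel _ (leqnn _))); apply: lerD => //.
by rewrite ler_wpM2l ?exprn_ge0 ?(ltW g0) //; case/andP: (valueE_bounds g k.+1).
Qed.

(** Here the leftover value is non-negative and is dropped; the loss is the discounted tail of the
    costs. *)
Lemma Jcost_greedy_le gs : (forall x y a, Q x y (gs x y) <= Q x y a) ->
  Jcost f pw p0 q gamma cost h (greedy_strategy mstar gs) <=
  valueE f pw p0 q mstar (greedy_strategy mstar gs) 0 (qmin Q)
     + gamma ^+ k.+1 * (cmax / (1 - gamma)).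
Proof.
case/andP: (gamma01) => g0 _ opt; set g := greedy_strategy mstar gs.
have [/andP[_ J1]] := discounted_limn_bounds gamma01 (Ecost_bounds g) k.+1.
have tel N : (N <= k.+1)%N -> valueE f pw p0 q mstar g 0 (qmin Q) =
    \sum_(t < N) gamma ^+ t * Ecost f pw p0 q cost h g t
     + gamma ^+ N * valueE f pw p0 q mstar g N (qmin Q).
  elim: N => [|N IH] Nk; first by rewrite big_ord0 add0r mul1r.
  rewrite IH ?(ltnW Nk) // big_ord_recr /= -addrA; congr (_ + _).
  by rewrite exprSr -mulrA -mulrDr; congr (_ * _); exact: valueE_greedy_step.
apply: (le_trans J1); rewrite lerD2r (tel _ (leqnn _)) lerDl mulr_ge0 ?exprn_ge0 ?(ltW g0) //.
by case/andP: (valueE_bounds g k.+1).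
Qed.

End PartB.

(** As [ln gamma] is negative, the bound on [k] says that [gamma ^+ k] is at most (1 - gamma) eps /
    (2 cmax). The 2 leaves half of [eps] for each of the two comparisons. *)
Lemma horizon_error (R : realType) (gamma eps cmax : R) k :
  0 < gamma < 1 -> 0 < eps -> 0 < cmax ->
  ln ((1 - gamma) * eps / (2 * cmax)) / ln gamma <= k%:R ->
  gamma ^+ k.+1 * (cmax / (1 - gamma)) <= eps / 2.
Proof.
move=> /andP[g0 g1] e0 c0 kP.
have lg : ln gamma < 0 by rewrite ln_lt0 // g0.
have x0 : 0 < (1 - gamma) * eps / (2 * cmax).
  by rewrite divr_gt0 ?mulr_gt0 // subr_gt0.
have gk : gamma ^+ k <= (1 - gamma) * eps / (2 * cmax).
  rewrite -ler_ln ?posrE ?exprn_gt0 // lnXn //.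
  by rewrite -[ln gamma *+ k]mulr_natl -ler_ndivrMr.
have : gamma ^+ k.+1 <= (1 - gamma) * eps / (2 * cmax).
  apply: le_trans gk; rewrite exprS ger_pMl ?exprn_gt0 //; exact: ltW.
move=> gk1; have d0 : 0 < 1 - gamma by rewrite subr_gt0.
apply: (@le_trans _ _ ((1 - gamma) * eps / (2 * cmax) * (cmax / (1 - gamma)))).
  by rewrite ler_wpM2r // divr_ge0 ?ltW.
rewrite le_eqVlt; apply/orP; left; apply/eqP; field.
by rewrite !gt_eqF.
Qed.

Local Open Scope classical_set_scope.

(** * Almost sure convergence of the noise *)

Section FiniteValued.
Context {R : realType} d {Omega : measurableType d} (P : probability Omega R).

Definition Pr (A : set Omega) : R := fine (P A).

Lemma PrE A : measurable A -> (Pr A)%:E = P A.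
Proof. by move=> mA; rewrite fineK // fin_num_measure. Qed.

Lemma Pr_ge0 A : 0 <= Pr A.
Proof. by rewrite fine_ge0. Qed.

Lemma PrT : Pr setT = 1.
Proof. by rewrite /Pr probability_setT. Qed.

Lemma measurable_pred_fin (I : finType) (V : Omega -> I) (G : pred I) :
  (forall i, measurable [set w | V w = i]) -> measurable [set w | G (V w)].
Proof.
move=> mV.
have -> : [set w | G (V w)] = \bigcup_(i in [set i | G i]) [set w | V w = i].
  by apply/seteqP; split=> [w Gw|w [i Gi /= ->]] /=; [exists (V w)|].
exact: fin_bigcup_measurable.
Qed.

Lemma Pr_fin (I : finType) (V : Omega -> I) (D : set Omega) :
  measurable D -> (forall i, measurable [set w | V w = i]) ->
  Pr D = \sum_i Pr [set w | D w /\ V w = i].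
Proof.
move=> mD mV.
have mDV i : measurable [set w | D w /\ V w = i] by apply: measurableI; [|exact: mV].
apply: EFin_inj; rewrite PrE // -sumEFin.
under eq_bigr do rewrite PrE //.
transitivity (P (\bigcup_(i in [set: I]) [set w | D w /\ V w = i])).
  congr (P _); apply/seteqP; split=> [w Dw|w [i _ []]] //; by exists (V w).
have finI : finite_set [set: I] by exact: finite_finset.
rewrite measure_fin_bigcup //; last first.
  by move=> i j _ _ [w [[_ /= e1] [_ /= e2]]]; rewrite -e1 -e2.
rewrite fsbig_finite //=.
apply: perm_big; apply: uniq_perm; rewrite ?finmap.fset_uniq ?index_enum_uniq // => i.
by rewrite in_fset_set // in_setT mem_index_enum.
Qed.

End FiniteValued.

Section Noise.
Context {R : realType} d {Omega : measurableType d} (P : probability Omega R).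
Context {Zt Ut : finType}.
Variables (Z : nat -> Omega -> Zt) (U : nat -> Omega -> Ut).
Hypothesis mZ : forall n v, measurable [set w | Z n w = v].
Hypothesis mU : forall n v, measurable [set w | U n w = v].

(* Newest sample first, so that one step of the process is one cons. *)
Fixpoint past n w : seq (Zt * Ut) :=
  if n is m.+1 then (Z m w, U m w) :: past m w else [::].

Lemma size_past n w : size (past n w) = n.
Proof. by elim: n => //= n ->. Qed.

Lemma measurable_past n t : measurable [set w | past n w = t].
Proof.
elim: n t => [|n IH] [|[z u] t] /=.
- by have -> : [set w : Omega | [::] = [::] :> seq (Zt * Ut)] = setT by apply/seteqP; split.
- by have -> : [set w : Omega | [::] = (z, u) :: t] = set0 by apply/seteqP; split.
- by have -> : [set w : Omega | (Z n w, U n w) :: past n w = [::]] = set0 by apply/seteqP; split.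
have -> : [set w | (Z n w, U n w) :: past n w = (z, u) :: t] =
  [set w | Z n w = z] `&` [set w | U n w = u] `&` [set w | past n w = t].
  apply/seteqP; split=> [w [<- <- <-]//|w [[/= <- <-] <-] //].
by apply: measurableI => //; apply: measurableI.
Qed.

Variable kap : Zt -> Ut -> R.
Hypothesis kap_ge0 : forall z u, 0 <= kap z u.
Hypothesis kap_sum : forall z, \sum_u kap z u = 1.
Hypothesis kapP : forall n t z u,
  P [set w | past n w = t /\ Z n w = z /\ U n w = u] =
  ((kap z u)%:E * P [set w | past n w = t /\ Z n w = z])%E.

Let p n t := Pr P [set w | past n w = t].
Let r n t z := Pr P [set w | past n w = t /\ Z n w = z].

Let p_cons n z u t : p n.+1 ((z, u) :: t) = kap z u * r n t z.
Proof.
rewrite /p /r /Pr /=.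
have -> : [set w | (Z n w, U n w) :: past n w = (z, u) :: t] =
   [set w | past n w = t /\ Z n w = z /\ U n w = u].
  by apply/seteqP; split=> w /=; [case=> -> -> ->|case=> -> [-> ->]].
rewrite kapP fineM // fin_num_measure //.
by apply: measurableI; [exact: measurable_past|exact: mZ].
Qed.

Let r_sum n t : \sum_z r n t z = p n t.
Proof. by rewrite /p (@Pr_fin _ _ _ P _ (Z n)); [|exact: measurable_past|exact: mZ]. Qed.

(** Stands for the expectation of [F (past n w)]: histories of length [n] are finitely many, so a
    finite sum replaces the integral. *)
Definition histE n (F : seq (Zt * Ut) -> R) := \sum_(t : n.-tuple (Zt * Ut)) p n t * F t.

(** Tower property: given the past and the current state [z], the outcome has law [kap z]. *)
Lemma histE_step n F : histE n.+1 F =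
  \sum_(t : n.-tuple (Zt * Ut)) \sum_z r n t z * \sum_u kap z u * F ((z, u) :: t).
Proof.
rewrite /histE (big_tuple_cons _ (fun t => p n.+1 t * F t)) exchange_big /=.
apply: eq_bigr => t _.
rewrite big_pair_fin.
apply: eq_bigr => z _; rewrite mulr_sumr; apply: eq_bigr => u _.
by rewrite p_cons -mulrA mulrCA.
Qed.

Definition pastT n w : n.-tuple (Zt * Ut) := Tuple (introT eqP (size_past n w)).

Lemma pastT_eq n (t : n.-tuple (Zt * Ut)) :
  [set w | pastT n w = t] = [set w | past n w = t].
Proof.
apply/seteqP; split=> w /=; first by move=> <-.
by move=> e; apply: val_inj.
Qed.

Lemma measurable_pastT n t : measurable [set w | pastT n w = t].
Proof. by rewrite pastT_eq; exact: measurable_past. Qed.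

Lemma measurable_past_pred n (G : pred (seq (Zt * Ut))) : measurable [set w | G (past n w)].
Proof.
exact: (measurable_pred_fin (fun t : n.-tuple _ => G t) (@measurable_pastT n)).
Qed.

Lemma Pr_past n (G : pred (seq (Zt * Ut))) :
  Pr P [set w | G (past n w)] = histE n (fun t => (G t)%:R).
Proof.
rewrite (@Pr_fin _ _ _ P _ (pastT n)); [|exact: measurable_past_pred|exact: measurable_pastT].
apply: eq_bigr => t _; have [Gt|/negP nGt] := boolP (G t).
  rewrite mulr1 /p; congr (Pr P _); rewrite -(pastT_eq t).
  by apply/seteqP; split=> w [] //= e; split; rewrite // -[past n w]/(val (pastT n w)) e.
rewrite mulr0; have -> : [set w | [set w | G (past n w)] w /\ pastT n w = t] = set0.
  by apply/seteqP; split=> w //= [Gw e]; apply: nGt; rewrite -e.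
by rewrite /Pr measure0.
Qed.

Lemma histE1 n : histE n (fun=> 1) = 1.
Proof.
rewrite -[RHS](PrT P) -[LHS]/(histE n (fun t => (predT t)%:R)) -Pr_past.
by congr (Pr P _); apply/seteqP; split.
Qed.

Lemma histE_scale n c F : histE n (fun t => c * F t) = c * histE n F.
Proof. by rewrite /histE mulr_sumr; apply: eq_bigr => t _; rewrite mulrCA. Qed.

Section Transform.
Variables (om : seq (Zt * Ut) -> Zt -> Ut -> R) (D : R).
Hypothesis om_mean : forall t z, \sum_u kap z u * om t z u = 0.
Hypothesis om_le : forall t z u, `|om t z u| <= D.

(** [M] is a martingale transform, its gain being known before the noise is drawn. The cross term
    has mean 0, so [M ^+ 2 - D ^+ 2 * V] is a supermartingale. Only the recursions of [M] and [V]
    are assumed, so that fixpoints on histories fit directly. *)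
Lemma transform_L2 (g : seq (Zt * Ut) -> Zt -> R) (M V : seq (Zt * Ut) -> R) n :
  M [::] = 0 -> V [::] = 0 ->
  (forall t z u, M ((z, u) :: t) = M t + g t z * om t z u) ->
  (forall t z u, V ((z, u) :: t) = V t + g t z ^+ 2) ->
  histE n (fun t => M t ^+ 2 - D ^+ 2 * V t) <= 0.
Proof.
move=> M0 V0 MS VS; elim: n => [|n IH].
  rewrite /histE (big_tuple0 (fun t => p 0 t * (M t ^+ 2 - D ^+ 2 * V t))) M0 V0.
  by rewrite expr0n !mulr0 subr0 mulr0.
apply: le_trans IH; rewrite histE_step /histE; apply: ler_sum => t _.
rewrite -r_sum mulr_suml; apply: ler_sum => z _.
rewrite ler_wpM2l ?Pr_ge0 //.
apply: (@le_trans _ _ (\sum_u (kap z u * (M t ^+ 2 - D ^+ 2 * V t) +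
    2 * M t * g t z * (kap z u * om t z u)))).
  apply: ler_sum => u _; rewrite MS VS.
  have -> : kap z u * (M t ^+ 2 - D ^+ 2 * V t) + 2 * M t * g t z * (kap z u * om t z u)
    = kap z u * (M t ^+ 2 - D ^+ 2 * V t + 2 * M t * g t z * om t z u) by ring.
  rewrite ler_wpM2l //.
  have : om t z u ^+ 2 <= D ^+ 2.
    by rewrite -real_normK ?num_real // ler_sqr ?nnegrE // (le_trans _ (om_le t z u)).
  have := sqr_ge0 (g t z); nra.
by rewrite big_split /= -mulr_suml kap_sum mul1r -mulr_sumr om_mean mulr0 addr0.
Qed.

Variable b : seq (Zt * Ut) -> Zt -> R.

Section Frozen.
Variables (m : nat) (eta e : R).
Hypotheses (eta_ge0 : 0 <= eta) (e_gt0 : 0 < e).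

Fixpoint energy (t : seq (Zt * Ut)) : R :=
  if t is (z, _) :: t' then energy t' + (if (m <= size t')%N then b t' z ^+ 2 else 0)
  else 0.

(** The next gain is known before its noise, so its square is tested against [eta] in advance and
    the threshold is never overshot. *)
Definition alive t z := (m <= size t)%N && (energy t + b t z ^+ 2 <= eta).

(* Sum of the noise from time m on, stopped as soon as the squared gains would exceed eta or its
   absolute value has exceeded e.  Freezing turns Chebyshev's inequality at time n into a maximal
   inequality over all times up to n. *)
Fixpoint frozen (t : seq (Zt * Ut)) : R :=
  if t is (z, u) :: t' then
    frozen t' + (if alive t' z && (`|frozen t'| <= e) then b t' z else 0) * om t' z u
  else 0.

Let gain t z := if alive t z && (`|frozen t| <= e) then b t z else 0.

Fixpoint spent (t : seq (Zt * Ut)) : R :=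
  if t is (z, _) :: t' then spent t' + gain t' z ^+ 2 else 0.

(** The first bound drives the second: a gain is spent only if [energy] plus its square is at most
    [eta], and [spent] is at most [energy]. *)
Lemma spent_bounds t : spent t <= energy t /\ spent t <= eta.
Proof.
elim: t => [|[z u] t [IH1 IH2]] //=; rewrite /gain /alive.
have := sqr_ge0 (b t z).
case: (leqP m (size t)) => _ /=; last by rewrite expr0n addr0 addr0.
by case: ifP => [/andP[h _]|_]; rewrite ?expr0n /=; split; lra.
Qed.

Lemma frozen_tail n : Pr P [set w | e < `|frozen (past n w)|] <= D ^+ 2 * eta / e ^+ 2.
Proof.
have L2 := transform_L2 n (g := gain) (M := frozen) (V := spent)
  erefl erefl (fun _ _ _ => erefl) (fun _ _ _ => erefl).
rewrite (Pr_past n (fun t => e < `|frozen t|)) ler_pdivlMr ?exprn_gt0 // mulrC -histE_scale.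
have c1 : D ^+ 2 * eta = histE n (fun=> D ^+ 2 * eta * 1).
  by rewrite histE_scale histE1 mulr1.
rewrite [leRHS]c1 -[leRHS]addr0.
apply: (@le_trans _ _ (histE n (fun=> D ^+ 2 * eta * 1) +
   histE n (fun t => frozen t ^+ 2 - D ^+ 2 * spent t))); last by rewrite lerD2l.
rewrite /histE -big_split; apply: ler_sum => t _ /=; rewrite -mulrDr ler_wpM2l ?Pr_ge0 //.
have [_ st] := spent_bounds t.
have : D ^+ 2 * spent t <= D ^+ 2 * eta by rewrite ler_wpM2l ?sqr_ge0.
case: ltP => [h|_] /=; rewrite ?mulr0 !mulr1; have := sqr_ge0 (frozen t); first last; first by lra.
have : e ^+ 2 <= frozen t ^+ 2.
  by rewrite -[leRHS]real_normK ?num_real // ler_sqr ?nnegrE ?ltW // (lt_trans e_gt0).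
by lra.
Qed.

(** A sum frozen above [e] never moves again, so the events increase with [n] and the bound passes
    to the union by continuity from below. *)
Lemma frozen_ever :
  (P (\bigcup_n [set w | (e < `|frozen (past n w)|)%R]) <= (D ^+ 2 * eta / e ^+ 2)%:E)%E.
Proof.
have mF n := measurable_past_pred n (fun t => e < `|frozen t|).
have nd : {homo (fun n => [set w | e < `|frozen (past n w)|]) : i j / (i <= j)%N >-> (i <= j)%O}.
  apply/nondecreasing_seqP => n; apply/subsetPset => w /= h.
  by rewrite (leNgt _ e) h /= andbF mul0r addr0.
have cv := nondecreasing_cvg_mu (mu := P) mF (bigcup_measurable (fun n _ => mF n)) nd.
rewrite -(cvg_lim _ cv) //; apply: lime_le; first by apply/cvg_ex; eexists; exact: cv.
by near=> n; rewrite /= -PrE // lee_fin frozen_tail.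
Unshelve. all: by end_near. Qed.

Lemma frozenE w n : (forall N, energy (past N w) <= eta) ->
  (forall N, `|frozen (past N w)| <= e) -> 
  frozen (past n w) = \sum_(m <= s < n) b (past s w) (Z s w) * om (past s w) (Z s w) (U s w).
Proof.
move=> en fr; elim: n => [|n IH]; first by rewrite big_geq.
rewrite /= fr andbT /alive size_past.
have := en n.+1; rewrite /= size_past.
case: (leqP m n) => mn => [h|_] /=; last by rewrite mul0r addr0 IH !big_geq // ltnW.
by rewrite h IH big_nat_recr.
Qed.

End Frozen.

Lemma energyE m w n :
  energy m (past n w) = \sum_(m <= s < n) b (past s w) (Z s w) ^+ 2.
Proof.
elim: n => [|n IH]; first by rewrite big_geq.
rewrite /= size_past IH; case: (leqP m n) => mn; first by rewrite big_nat_recr.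
by rewrite addr0 !big_geq // ltnW.
Qed.

Hypothesis b_sq : {ae P, forall w, cvgn (fun N => \sum_(t < N) b (past t w) (Z t w) ^+ 2)}.

Let late (eta : R) m := \bigcup_N [set w | eta < energy m (past N w)].

Let m_late (eta : R) m : measurable (late eta m).
Proof.
by apply: bigcup_measurable => N _; exact: (measurable_past_pred N (fun t => eta < energy m t)).
Qed.

(** The events decrease in [m], and on their intersection the sums of squared gains are not Cauchy,
    which is negligible by [b_sq]; continuity from above concludes. *)
Lemma late_cvg0 (eta : R) : 0 < eta -> (fun m => P (late eta m)) @ \oo --> 0%E.
Proof.
move=> e0.
have mI : measurable (\bigcap_m late eta m) by apply: bigcap_measurable.
have <- : P (\bigcap_m late eta m) = 0.
  apply/negligibleP => //; apply: negligibleS b_sq => w /= h cv.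
  have /cauchy_cvgP/cauchy_ballP/(_ _ e0) := cv.
  move=> [[A1 A2]] /= [[m1 _ h1] [m2 _ h2]] /= AA.
  pose m := maxn m1 m2.
  have [N _ /=] := h m I; rewrite energyE.
  case: (leqP m N) => mN; last by rewrite big_geq ?(ltnW mN) // ltNge (ltW e0).
  pose u N := \sum_(t < N) b (past t w) (Z t w) ^+ 2.
  have /= := AA (u m, u N) (conj (h1 m (leq_maxl _ _)) (h2 N (leq_trans (leq_maxr _ _) mN))).
  rewrite /u /ball /= distrC -!(big_mkord xpredT (fun t => b (past t w) (Z t w) ^+ 2)).
  rewrite (big_cat_nat _ mN) //= addrAC subrr add0r ger0_norm; last first.
    by apply: sumr_ge0 => s _; exact: sqr_ge0.
  by move=> /lt_trans/[apply]; rewrite ltxx.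
apply: nonincreasing_cvg_mu => //.
  by rewrite (le_lt_trans (probability_le1 _ _)) ?ltry.
apply/nonincreasing_seqP => m; apply/subsetPset => w /= [N _ /= h]; exists N => //=.
apply: lt_le_trans h _; rewrite !energyE.
case: (ltnP m N) => mN; last by rewrite !big_geq // ltnW.
by rewrite [leRHS]big_ltn // lerDr sqr_ge0.
Qed.

Let tail m n w := \sum_(m <= s < n) b (past s w) (Z s w) * om (past s w) (Z s w) (U s w).

Lemma noise_small_ae (e : R) : 0 < e -> {ae P, forall w, exists m, forall n, `|tail m n w| <= e}.
Proof.
move=> e0.
have H j : exists B, [/\ measurable B, (P B <= (j.+1%:R^-1)%:E)%E &
    ~` [set w | exists m, forall n, `|tail m n w| <= e] `<=` B].
  (* Each of the two bad events gets half of [j.+1%:R^-1]. The choice of [eta] gives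
     [D ^+ 2 * eta / e ^+ 2 <= x]; the denominator is [D ^+ 2 + 1] because [D] may be 0. *)
  pose x : R := (2 * j.+1%:R)^-1.
  have x0 : 0 < x by rewrite invr_gt0 mulr_gt0.
  pose eta := x * e ^+ 2 / (D ^+ 2 + 1).
  have D1 : 0 < D ^+ 2 + 1 by rewrite ltr_wpDl ?sqr_ge0.
  have eta0 : 0 < eta by rewrite divr_gt0 // mulr_gt0 // exprn_gt0.
  have [m hm] : exists m, (P (late eta m) <= x%:E)%E.
    have /fine_cvgP[_ /cvgrPdist_le/(_ _ x0) [m _ /(_ m (leqnn m))]] := late_cvg0 eta0.
    rewrite /= sub0r normrN => hx; exists m.
    by rewrite -PrE // lee_fin; exact: le_trans (ler_norm _) hx.
  pose F := \bigcup_n [set w | e < `|frozen m eta e (past n w)|].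
  have mF : measurable F.
    by apply: bigcup_measurable => n _;
       exact: (measurable_past_pred n (fun t => e < `|frozen m eta e t|)).
  exists (late eta m `|` F); split; first exact: measurableU.
    apply: (le_trans (measureU2 _ _ _)) => //.
    apply: (le_trans (leeD hm (frozen_ever m (ltW eta0) e0))).
    rewrite -EFinD lee_fin.
    have : D ^+ 2 * eta / e ^+ 2 <= x.
      rewrite ler_pdivrMr ?exprn_gt0 // /eta mulrA ler_pdivrMr // mulrC.
      have : 0 < x * e ^+ 2 by rewrite mulr_gt0 // exprn_gt0.
      by nra.
    have -> : j.+1%:R^-1 = x + x.
      rewrite /x invfM; move: (j.+1%:R^-1 : R) => y; lra.
    by rewrite lerD2l.
  move=> w /= nw; apply: contrapT => /not_orP[nl nF]; apply: nw; exists m => n.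
  rewrite /tail -(@frozenE m eta e).
  - by rewrite leNgt; apply/negP => h; apply: nF; exists n.
  - by move=> N; rewrite leNgt; apply/negP => h; apply: nl; exists N.
  - by move=> N; rewrite leNgt; apply/negP => h; apply: nF; exists N.
have [B HB] := choice H.
exists (\bigcap_j B j); split.
- by apply: bigcap_measurable => // j _; case: (HB j).
- apply/eqP; rewrite eq_le measure_ge0 andbT; apply/lee_addgt0Pr => x x0; rewrite add0e.
  have [j hj] := ltr_add_invr x0.
  have [mB PB _] := HB j.
  apply: (@le_trans _ _ (P (B j))).
    rewrite le_measure ?inE //; last exact: bigcap_inf.
    by apply: bigcap_measurable => // i _; case: (HB i).
  by apply: (le_trans PB); rewrite lee_fin -[leLHS]add0r ltW.
- by move=> w hw j _; case: (HB j) => _ _; exact.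
Qed.

End Transform.
End Noise.

(** * Deterministic stochastic approximation *)

Section StochasticApproximation.
Variable R : realType.

Lemma smoothing (al u : nat -> R) (c : R) t0 :
  (forall t, 0 <= al t <= 1) -> (fun N => \sum_(t < N) al t) @ \oo --> +oo ->
  (forall t, (t0 <= t)%N -> u t.+1 <= (1 - al t) * u t + al t * c) ->
  forall e, 0 < e -> exists N, forall t, (N <= t)%N -> u t <= c + e.
Proof.
move=> al01 al_oo step e e0.
pose s n := \sum_(t0 <= t < n) al t.
have s_ge0 n : 0 <= s n by apply: sumr_ge0 => t _; case/andP: (al01 t).
pose C := `|u t0 - c|.
(* (1 - a) (1 + s + a) <= 1 + s, so the product of the factors 1 - al is at most 1 / (1 + s). *)
have bnd n : (t0 <= n)%N -> u n - c <= C / (1 + s n).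
  elim: n => [|n IH]; first by rewrite leqn0 => /eqP e1; rewrite /s e1 big_geq // addr0 divr1 /C e1 ler_norm.
  rewrite leq_eqVlt => /predU1P[<-|]; first by rewrite /s big_geq // addr0 divr1 ler_norm.
  rewrite ltnS => tn; have {}IH := IH tn; have := step _ tn.
  have /andP[a0 a1] := al01 n.
  rewrite /s big_nat_recr // -/(s n) /=.
  have sn := s_ge0 n.
  have p0 : 0 < 1 + s n by lra.
  have p1 : 0 < 1 + (s n + al n) by lra.
  rewrite ler_pdivlMr // => h.
  have h2 : u n.+1 - c <= (1 - al n) * (C / (1 + s n)).
    have : (1 - al n) * (u n - c) <= (1 - al n) * (C / (1 + s n)).
      by rewrite ler_wpM2l // subr_ge0.
    by lra.
  apply: (@le_trans _ _ ((1 - al n) * (C / (1 + s n)) * (1 + (s n + al n)))).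
    by rewrite ler_pM2r.
  have -> : (1 - al n) * (C / (1 + s n)) * (1 + (s n + al n)) =
     C - C * (al n * (s n + al n) / (1 + s n)).
    by field; rewrite gt_eqF.
  rewrite gerBl mulr_ge0 ?normr_ge0 // divr_ge0 ?mulr_ge0 ?addr_ge0 //; lra.
(* From [N] on, the rates after [t0] sum to at least [C / e], which brings [C / (1 + s t)] below
   [e]. *)
have /cvgryPge/(_ (\sum_(t < t0) al t + C / e)) [N _ hN] := al_oo.
exists (maxn N t0) => t; rewrite geq_max => /andP[Nt tt]; have := hN _ Nt.
rewrite /= -!(big_mkord xpredT al) (big_cat_nat _ tt) //= lerD2l -/(s t) => hs.
have := bnd _ tt; have : C / (1 + s t) <= e.
  rewrite ler_pdivrMr; last by have := s_ge0 t; lra.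
  by move: hs; rewrite ler_pdivrMr //; lra.
lra.
Qed.

Lemma noisy_smoothing (x al om g : nat -> R) (c : R) n0 :
  (forall t, 0 <= al t <= 1) -> (fun N => \sum_(t < N) al t) @ \oo --> +oo ->
  (forall e, 0 < e -> exists m, forall n, `|\sum_(m <= s < n) al s * om s| <= e) ->
  (forall t, x t.+1 = (1 - al t) * x t + al t * (g t + om t)) ->
  (forall t, (n0 <= t)%N -> g t <= c) ->
  forall e, 0 < e -> exists N, forall t, (N <= t)%N -> x t <= c + e.
Proof.
move=> al01 al_oo small xS gc e e0.
(* One third each for the noise sum inside the averaged target, the smoothing error, and the noise
   sum added back at the end. *)
have e3 : 0 < e / 3 by lra.
have [m hm] := small _ e3.
pose s t := \sum_(m <= r < t) al r * om r.
(* Subtracting the partial noise sums makes the recursion noiseless. *)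
have step t : (maxn m n0 <= t)%N ->
    x t.+1 - s t.+1 <= (1 - al t) * (x t - s t) + al t * (c + e / 3).
  rewrite geq_max => /andP[mt nt]; rewrite xS /s big_nat_recr // -/(s t) /=.
  have /andP[a0 _] := al01 t.
  have := hm t; rewrite -/(s t) ler_norml => /andP[st _].
  have := gc t nt => gt.
  have : al t * (g t - s t) <= al t * (c + e / 3) by rewrite ler_wpM2l //; lra.
  by lra.
have [N hN] := smoothing al01 al_oo step e3.
exists N => t Nt; have := hN t Nt.
by have := hm t; rewrite -/(s t) ler_norml => /andP[_]; lra.
Qed.

Variables (I : finType) (H : (I -> R) -> I -> R) (Qs : I -> R) (gamma : R).
Hypothesis gamma01 : 0 < gamma < 1.
Hypothesis H_contract : forall f (B : R), (forall z, `|f z - Qs z| <= B) ->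
  forall z, `|H f z - Qs z| <= gamma * B.
Variables (Q al om : nat -> I -> R) (B : R).
Hypothesis al01 : forall t z, 0 <= al t z <= 1.
Hypothesis al_oo : forall z, (fun N => \sum_(t < N) al t z) @ \oo --> +oo.
Hypothesis om_small : forall z (e : R), 0 < e ->
  exists m, forall n, `|\sum_(m <= s < n) al s z * om s z| <= e.
Hypothesis QS : forall t z,
  Q t.+1 z = (1 - al t z) * Q t z + al t z * (H (Q t) z + om t z).
Hypothesis Q_bounded : forall t z, `|Q t z - Qs z| <= B.

Lemma contraction_step C e : 0 < e ->
  (exists N, forall t, (N <= t)%N -> forall z, `|Q t z - Qs z| <= C) ->
  exists N, forall t, (N <= t)%N -> forall z, `|Q t z - Qs z| <= gamma * C + e.
Proof.
move=> e0 [n0 hC].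
have hz z : exists N, forall t, (N <= t)%N -> `|Q t z - Qs z| <= gamma * C + e.
  have hH t : (n0 <= t)%N -> `|H (Q t) z - Qs z| <= gamma * C.
    by move=> nt; apply: H_contract => z'; exact: hC.
  have [N1 h1] : exists N, forall t, (N <= t)%N -> Q t z - Qs z <= gamma * C + e.
    apply: (@noisy_smoothing _ (fun t => al t z) (fun t => om t z)
      (fun t => H (Q t) z - Qs z) _ n0) => // [e'|t|t nt].
    - exact: om_small.
    - by rewrite QS; ring.
    - exact: le_trans (ler_norm _) (hH t nt).
  have [N2 h2] : exists N, forall t, (N <= t)%N -> - (Q t z - Qs z) <= gamma * C + e.
    apply: (@noisy_smoothing _ (fun t => al t z) (fun t => - om t z)
      (fun t => - (H (Q t) z - Qs z)) _ n0) => // [e' e'0|t|t nt].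
    - have [m hm] := om_small z e'0; exists m => n.
      under eq_bigr do rewrite mulrN.
      by rewrite sumrN normrN.
    - by rewrite QS; ring.
    - by apply: le_trans (hH t nt); rewrite -normrN ler_norm.
  exists (maxn N1 N2) => t; rewrite geq_max => /andP[t1 t2].
  by rewrite ler_norml h1 // andbT lerNl h2.
have [N hN] := choice hz.
exists (\max_z N z) => t Nt z; apply: hN; apply: leq_trans Nt.
exact: leq_bigmax.
Qed.

Lemma contraction_cvg z : (fun t => Q t z) @ \oo --> Qs z.
Proof.
case/andP: gamma01 => g0 g1.
apply/cvgrPdist_le => e e0.
have B0 : 0 <= B by exact: le_trans (Q_bounded 0 z).
have hj j : exists N, forall t, (N <= t)%N -> forall z, `|Q t z - Qs z| <= gamma ^+ j * B + e / 2.
  elim: j => [|j IH].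
    exists 0%N => t _ z'; apply: (le_trans (Q_bounded t z')); rewrite expr0 mul1r; lra.
  (* With this slack the error [e / 2] is reproduced exactly: gamma (e / 2) + (1 - gamma) (e / 2) =
     e / 2. *)
  have d0 : 0 < (1 - gamma) * (e / 2) by rewrite mulr_gt0; lra.
  have [N hN] := contraction_step d0 IH; exists N => t Nt z'.
  by apply: (le_trans (hN t Nt z')); rewrite exprS; lra.
have [j hgj] : exists j, gamma ^+ j * B <= e / 2.
  have g1' : `|gamma| < 1 by rewrite ger0_norm ?ltW.
  have x0 : 0 < e / 2 / (B + 1) by rewrite divr_gt0 //; lra.
  have /cvgrPdist_le/(_ _ x0) [j _ /(_ j (leqnn j))] := cvg_expr g1'.
  rewrite /= sub0r normrN ger0_norm ?exprn_ge0 ?(ltW g0) // ler_pdivlMr; last lra.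
  move=> h; exists j; apply: le_trans h; rewrite ler_wpM2l ?exprn_ge0 ?(ltW g0) //; lra.
have [N hN] := hj j.
exists N => // t /= Nt; rewrite distrC; apply: (le_trans (hN t Nt z)); lra.
Qed.

End StochasticApproximation.

(** * Q-learning *)

Section Kernel.
Variables (R : realType) (M : finType) (E : Type) (T : M -> M -> R) (q gamma : R).
Variables (cost : M -> E -> bool -> R) (h : (M -> R) -> E) (cmax : R).
Hypothesis T_ge0 : forall m' m, 0 <= T m' m.
Hypothesis T_sum : forall m, \sum_m' T m' m = 1.
Hypothesis q01 : 0 <= q <= 1.
Hypothesis gamma01 : 0 < gamma < 1.
Hypothesis cost_ge0 : forall m mh a, 0 <= cost m mh a.
Hypothesis cost_le : forall m mh a, cost m mh a <= cmax.
Variables (k : nat) (mstar : M).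

Local Notation state := (M * 'I_k.+1 * bool)%type.

Definition cost_of (p : M * state) : R :=
  cost p.1 (h (fun m' => Tpow T p.2.1.2 m' p.2.1.1)) p.2.2.

(** Restricting the costs to this finite set makes outcomes a finite type, as [past] requires. *)
Definition cost_vals : seq R := codom cost_of.

Lemma cost_of_val p : cost_of p \in cost_vals.
Proof. exact: codom_f. Qed.

Local Notation outcome := (seq_sub cost_vals * option M)%type.

Definition kap (z : state) (u : outcome) : R :=
  Kco q T cost h z.1.1 z.1.2 z.2 (val u.1) u.2.

Lemma obsNext_ge0 a m o : 0 <= obsNext q T a m o.
Proof.
case/andP: q01 => q0 q1; rewrite /obsNext; case: a => //.
by rewrite addr_ge0 // mulr_ge0 ?subr_ge0 //; case: o.
Qed.

Lemma obsNext_sum a m : \sum_o obsNext q T a m o = 1.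
Proof.
rewrite sum_option /obsNext; case: a => /=; last by rewrite big1 ?addr0.
rewrite mulr0 add0r mulr1; under eq_bigr do rewrite mulr0 addr0.
by rewrite -mulr_sumr T_sum mulr1 subrK.
Qed.

Lemma kap_ge0 z u : 0 <= kap z u.
Proof.
by apply: sumr_ge0 => m _; rewrite !mulr_ge0 ?Tpow_ge0 ?obsNext_ge0.
Qed.

Lemma Tpow_obsNext x y a o :
  \sum_m Tpow T y m x * obsNext q T a m o = Pobs q T x y a o.
Proof.
rewrite /Pobs /obsNext; case: a => /=; last first.
  by rewrite -mulr_suml Tpow_sum // mul0r subr0 !mul1r mul0r addr0.
case: o => [m'|] /=.
  rewrite mul1r !mulr0 add0r mulr_sumr; apply: eq_bigr => m _; ring.
rewrite !mulr0 !mulr1 mul1r addr0 add0r.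
by rewrite -mulr_suml Tpow_sum // mul1r.
Qed.

(** The cost is a function of the hidden type [m], so the sum over cost values collapses to a single
    term for each [m]. *)
Lemma kap_mean (G : R -> option M -> R) z : \sum_(u : outcome) kap z u * G (val u.1) u.2 =
  \sum_m \sum_o Tpow T z.1.2 m z.1.1 * obsNext q T z.2 m o * G (cost_of (m, z)) o.
Proof.
rewrite big_pair_fin exchange_big [RHS]exchange_big; apply: eq_bigr => o _ /=.
under eq_bigr do rewrite /kap /Kco mulr_suml.
rewrite exchange_big; apply: eq_bigr => m _ /=.
pose c0 : seq_sub cost_vals := SeqSub (cost_of_val (m, z)).
rewrite (bigD1 c0) //= eqxx mulr1 [X in _ + X]big1 ?addr0 // => c cc0.
rewrite [_ == _](_ : _ = false); first by rewrite mulr0 !mul0r.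
by apply: contra_neqF cc0 => /eqP e; apply: val_inj.
Qed.

Lemma kap_sum z : \sum_u kap z u = 1.
Proof.
under eq_bigr do rewrite -[kap _ _]mulr1.
rewrite (kap_mean (fun _ _ => 1)); under eq_bigr do under eq_bigr do rewrite mulr1.
under eq_bigr do rewrite -mulr_sumr obsNext_sum mulr1.
exact: Tpow_sum.
Qed.

Definition zmin (f : state -> R) (xy : M * 'I_k.+1) : R := Num.min (f (xy, false)) (f (xy, true)).

Definition bell (f : state -> R) (z : state) : R :=
  chat T cost h z.1.1 z.1.2 z.2 +
  gamma * \sum_o Pobs q T z.1.1 z.1.2 z.2 o * zmin f (ftilde mstar z.1 o).

Definition target (f : state -> R) (z : state) (u : outcome) : R :=
  val u.1 + gamma * zmin f (ftilde mstar z.1 u.2).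

Lemma kap_target f z : \sum_u kap z u * target f z u = bell f z.
Proof.
rewrite (kap_mean (fun c o => c + gamma * zmin f (ftilde mstar z.1 o))).
under eq_bigr do under eq_bigr do rewrite mulrDr.
under eq_bigr do rewrite big_split /=.
rewrite big_split /=; congr (_ + _).
  apply: eq_bigr => m _; rewrite -mulr_suml -mulr_sumr obsNext_sum mulr1 mulrC.
  by [].
rewrite exchange_big mulr_sumr; apply: eq_bigr => o _ /=.
rewrite -mulr_suml Tpow_obsNext; ring.
Qed.

Lemma min_dist (a b c e B : R) : `|a - b| <= B -> `|c - e| <= B ->
  `|Num.min a c - Num.min b e| <= B.
Proof.
rewrite !ler_norml => /andP[h1 h2] /andP[h3 h4].
by rewrite /Num.min; case: ltP => h5; case: ltP => h6; apply/andP; split; lra.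
Qed.

Lemma bell_contract f g (B : R) : (forall z, `|f z - g z| <= B) ->
  forall z, `|bell f z - bell g z| <= gamma * B.
Proof.
case/andP: gamma01 => g0 _ fg z.
rewrite /bell opprD addrACA subrr add0r -mulrBr normrM gtr0_norm // ler_wpM2l ?(ltW g0) //.
rewrite -sumrB; apply: (le_trans (ler_norm_sum _ _ _)).
rewrite -[leRHS]mul1r -[X in X * _](Pobs_sum T_sum q z.1.1 z.1.2 z.2) mulr_suml.
apply: ler_sum => o _; have P0 := Pobs_ge0 T_ge0 q01 z.1.1 z.1.2 z.2 o.
rewrite -mulrBr normrM ger0_norm // ler_wpM2l //.
exact: min_dist.
Qed.

Let bound := cmax / (1 - gamma).

Lemma cost_val_bounds (c : seq_sub cost_vals) : 0 <= val c <= cmax.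
Proof. by case: c => c /= /codomP[p ->]; rewrite cost_ge0 cost_le. Qed.

(** [bound] solves [bound = cmax + gamma * bound], so the interval is preserved by targets, hence
    also by averaging with them. *)
Lemma target_bounds f z u : (forall z, 0 <= f z <= bound) -> 0 <= target f z u <= bound.
Proof.
case/andP: gamma01 => g0 g1 hf; rewrite /target.
have /andP[c0 c1] := cost_val_bounds u.1.
have : 0 <= zmin f (ftilde mstar z.1 u.2) <= bound.
  rewrite /zmin le_min ge_min.
  by case/andP: (hf (ftilde mstar z.1 u.2, false)) => -> ->; case/andP: (hf (ftilde mstar z.1 u.2, true)) => ->.
move=> /andP[m0 m1]; rewrite addr_ge0 ?mulr_ge0 ?(ltW g0) //=.
have : gamma * zmin f (ftilde mstar z.1 u.2) <= gamma * bound by rewrite ler_wpM2l ?(ltW g0).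
have : bound = cmax + gamma * bound by rewrite /bound; field; rewrite subr_eq0 gt_eqF.
by move=> e1 h1; rewrite [leRHS]e1 lerD.
Qed.

Variable rate : seq (state * outcome) -> state -> R.
Hypothesis rate01 : forall p z, 0 <= rate p z <= 1.

Definition rate_at z0 p z : R := if z == z0 then rate p z else 0.

(** The iterates [Qit] as a function of the recorded history alone, which makes gain and noise
    predictable in the sense of [transform_L2]. *)
Fixpoint Qhist (p : seq (state * outcome)) : state -> R :=
  if p is (z, u) :: p' then
    fun z0 => (1 - rate_at z0 p' z) * Qhist p' z0 + rate_at z0 p' z * target (Qhist p') z0 u
  else fun=> 0.

Lemma rate_at01 z0 p z : 0 <= rate_at z0 p z <= 1.
Proof. by rewrite /rate_at; case: ifP => // _; rewrite lexx ler01. Qed.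

Lemma Qhist_bounds p z : 0 <= Qhist p z <= bound.
Proof.
elim: p z => [|[z u] p IH] z0 /=.
  rewrite lexx /bound divr_ge0 //; last by case/andP: gamma01; lra.
  exact: (le_trans (cost_ge0 mstar (h (fun=> 0)) true)).
have /andP[r0 r1] := rate_at01 z0 p z.
have /andP[a0 a1] := IH z0.
have /andP[b0 b1] := target_bounds z0 u IH.
apply/andP; split; first by rewrite addr_ge0 // mulr_ge0 // subr_ge0.
have : (1 - rate_at z0 p z) * Qhist p z0 <= (1 - rate_at z0 p z) * bound.
  by rewrite ler_wpM2l // subr_ge0.
have : rate_at z0 p z * target (Qhist p) z0 u <= rate_at z0 p z * bound.
  by rewrite ler_wpM2l.
lra.
Qed.

(** Centred under the law at the sampled state [z], not at [z0], so the mean is 0 for every [z]. The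
    two laws coincide whenever [rate_at z0 p z] is nonzero. *)
Definition noise z0 p z u : R :=
  target (Qhist p) z0 u - \sum_u' kap z u' * target (Qhist p) z0 u'.

Lemma noise_mean z0 p z : \sum_u kap z u * noise z0 p z u = 0.
Proof.
under eq_bigr do rewrite mulrBr.
by rewrite sumrB -mulr_suml kap_sum mul1r subrr.
Qed.

Lemma noise_le z0 p z u : `|noise z0 p z u| <= bound.
Proof.
have B u' := target_bounds z0 u' (Qhist_bounds p).
have /andP[t0 t1] := B u.
have /andP[s0 s1] := sum_weighted_bounds (kap_ge0 z) (kap_sum z) B.
by rewrite ler_norml /noise; apply/andP; split; lra.
Qed.

Lemma Qhist_step z0 p z u : Qhist ((z, u) :: p) z0 =
  (1 - rate_at z0 p z) * Qhist p z0 +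
  rate_at z0 p z * (bell (Qhist p) z0 + noise z0 p z u).
Proof.
rewrite /= /rate_at; case: eqP => [->|_]; last by rewrite !mul0r.
by rewrite /noise kap_target addrCA subrr addr0.
Qed.

End Kernel.

(** * Transfer from finite histories to the sample space *)

Section QLearning.
Variables (R : realType) (M : finType) (E : Type) (T : M -> M -> R) (q gamma : R).
Variables (cost : M -> E -> bool -> R) (h : (M -> R) -> E) (cmax : R).
Hypothesis T_ge0 : forall m' m, 0 <= T m' m.
Hypothesis T_sum : forall m, \sum_m' T m' m = 1.
Hypothesis q01 : 0 <= q <= 1.
Hypothesis gamma01 : 0 < gamma < 1.
Hypothesis cost_ge0 : forall m mh a, 0 <= cost m mh a.
Hypothesis cost_le : forall m mh a, cost m mh a <= cmax.
Variables (k : nat) (mstar : M).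
Variables (d : measure_display) (Omega : measurableType d) (P : probability Omega R).
Variables (X : nat -> Omega -> M) (Y : nat -> Omega -> 'I_k.+1) (A : nat -> Omega -> bool)
  (C : nat -> Omega -> R) (O : nat -> Omega -> option M) (al : nat -> Omega -> R).
Hypothesis mX : forall t v, measurable [set w | X t w = v].
Hypothesis mY : forall t v, measurable [set w | Y t w = v].
Hypothesis mA : forall t v, measurable [set w | A t w = v].
Hypothesis mC : forall t v, measurable [set w | C t w = v].
Hypothesis mO : forall t v, measurable [set w | O t w = v].

Local Notation state := (M * 'I_k.+1 * bool)%type.
Local Notation cvals := (cost_vals T cost h k).
Local Notation outcome := (seq_sub cvals * option M)%type.

Hypothesis KcoP : forall t hv (c' : R) (o : option M),
  P [set w | hist X Y A C O t w = hv /\ C t w = c' /\ O t w = o]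
  = ((Kco q T cost h hv.2.1.1 hv.2.1.2 hv.2.2 c' o)%:E
             * P [set w | hist X Y A C O t w = hv])%E.

(* C t is not assumed to be a measurable function; it is recoded through the finite set of possible
   costs, which it avoids with probability 0.  cost0 is the junk value used there. *)
Definition cost0 : seq_sub cvals := SeqSub (cost_of_val T cost h (mstar, (mstar, ord0, true))).
Definition Zs t w : state := (X t w, Y t w, A t w).
Definition Us t w : outcome := (insubd cost0 (C t w), O t w).

Definition decode (x : state * outcome) := (x.1.1.1, x.1.1.2, x.1.2, val x.2.1, x.2.2).

Lemma decode_inj : injective decode.
Proof. by move=> [[[? ?] ?] [? ?]] [[[? ?] ?] [? ?]] [-> -> -> /val_inj -> ->]. Qed.

Let regular t := [set w | C t w \in cvals].
Let regular_upto t := [set w | forall s, (s < t)%N -> regular s w].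

Lemma regularP t w : regular t w -> val (Us t w).1 = C t w.
Proof. by move=> r; rewrite /= val_insubd r. Qed.

Lemma hist_past t w : regular_upto t w ->
  hist X Y A C O t w = (map decode (rev (past Zs Us t w)), Zs t w).
Proof.
move=> r; rewrite /hist; congr (_, _).
elim: t r => [|t IH] r //.
have -> : iota 0 t.+1 = rcons (iota 0 t) t by rewrite -[t.+1]addn1 iotaD cats1.
rewrite /= rev_cons !map_rcons -IH; last by move=> s st; apply: r; exact: ltnW.
congr rcons.
by rewrite -[RHS]/(X t w, Y t w, A t w, val (Us t w).1, O t w) regularP //; exact: (r t).
Qed.

(** A decoded history contains only costs from [cvals], so equality with one forces regularity; this
    turns [KcoP] into a statement about [past]. The reversal is there because [hist] lists the
    oldest sample first. *)
Lemma hist_eq t p z : [set w | hist X Y A C O t w = (map decode (rev p), z)] =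
  regular_upto t `&` [set w | past Zs Us t w = p /\ Zs t w = z].
Proof.
apply/seteqP; split=> w /=; last by case=> r [<- <-]; exact: hist_past.
move=> hw; have r : regular_upto t w.
  move=> s st; rewrite /regular /=; have [e _] := hw.
  (* Compare the costs at position [s]: on the right it is the value of a [seq_sub], hence in
     [cvals]. *)
  have := congr1 (fun l => nth (C s w) (map (fun x : M * 'I_k.+1 * bool * R * option M => x.1.2) l) s) e.
  rewrite -!map_comp (nth_map 0%N) ?size_iota // nth_iota // add0n /=.
  have sp : (s < size (rev p))%N.
    by have := congr1 size e; rewrite !size_map size_iota => <-.
  rewrite (nth_map (Zs s w, Us s w)) //= => ->.
  exact: (valP (nth _ _ _).2.1).
split=> //; have := hist_past r; rewrite hw => -[e ->]; split=> //.
by have /(inj_map decode_inj)/(congr1 rev) := e; rewrite !revK.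
Qed.

Lemma measurable_regular t : measurable (regular t).
Proof.
have -> : regular t = \bigcup_(c in [set: seq_sub cvals]) [set w | C t w = val c].
  apply/seteqP; split=> w /=; first by move=> cw; exists (SeqSub cw).
  by case=> c _ /= e; rewrite /regular /= e; exact: valP.
by apply: fin_bigcup_measurable => //; exact: finite_finset.
Qed.

Lemma measurable_regular_upto t : measurable (regular_upto t).
Proof.
have -> : regular_upto t = \bigcap_(s in [set s | (s < t)%N]) regular s by [].
by apply: bigcap_measurableType => s _; exact: measurable_regular.
Qed.

Lemma measurable_Zs t v : measurable [set w | Zs t w = v].
Proof.
case: v => [[x y] a].
have -> : [set w | Zs t w = (x, y, a)] =
   [set w | X t w = x] `&` [set w | Y t w = y] `&` [set w | A t w = a].
  by apply/seteqP; split=> w; rewrite /Zs /=; [case=> -> -> ->|case=> -[-> ->] ->].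
by apply: measurableI => //; apply: measurableI.
Qed.

Lemma measurable_Us t v : measurable [set w | Us t w = v].
Proof.
case: v => [c o].
have -> : [set w | Us t w = (c, o)] = [set w | O t w = o] `&`
   ((regular t `&` [set w | C t w = val c]) `|`
    (~` regular t `&` [set w | cost0 = c])).
  apply/seteqP; split=> w /=.
    case=> e1 e2; split=> //; have [r|nr] := pselect (regular t w); [left|right]; split=> //.
      by rewrite -(regularP r) /= e1.
    by rewrite -e1; apply: val_inj; rewrite val_insubd ifF //; apply/negP.
  case=> e2 [[r e]|[nr e]]; rewrite /Us e2; congr (_, _); apply: val_inj; rewrite val_insubd.
    by rewrite (r : is_true _).
  by rewrite ifF ?e //; apply/negP.
apply: measurableI => //; apply: measurableU; apply: measurableI => //.
- exact: measurable_regular.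
- exact/measurableC/measurable_regular.
have [e|ne] := pselect (cost0 = c).
  by have -> : [set w : Omega | cost0 = c] = setT by apply/seteqP; split.
by have -> : [set w : Omega | cost0 = c] = set0 by apply/seteqP; split.
Qed.

Lemma atom_eq t p z (u : outcome) :
  [set w | hist X Y A C O t w = (map decode (rev p), z) /\ C t w = val u.1 /\ O t w = u.2] =
  regular_upto t.+1 `&` [set w | past Zs Us t w = p /\ Zs t w = z /\ Us t w = u].
Proof.
have he := hist_eq t p z.
apply/seteqP; split=> w /=.
  case=> hw [cw ow].
  have [r [pw zw]] : (regular_upto t `&` [set w | past Zs Us t w = p /\ Zs t w = z]) w.
    by rewrite -he.
  have rt : regular t w by rewrite /regular /= cw; exact: valP.
  split.
    by move=> s; rewrite ltnS leq_eqVlt => /predU1P[->//|]; exact: r.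
  split=> //; split=> //; rewrite /Us ow; case: (u) cw => [c o] /= cw; congr (_, _).
  by apply: val_inj; rewrite -[LHS]/(val (Us t w).1) regularP //; exact: cw.
case=> r [pw [zw uw]].
have : (regular_upto t `&` [set w | past Zs Us t w = p /\ Zs t w = z]) w.
  by split=> // s st; apply: r; exact: ltnW.
rewrite -he /= => ->; split=> //; rewrite -uw; split=> //.
by rewrite -(regularP (r t (leqnn _))).
Qed.

Lemma measurable_past_Zs t p z : measurable [set w | past Zs Us t w = p /\ Zs t w = z].
Proof.
apply: measurableI; last exact: measurable_Zs.
exact: (measurable_past measurable_Zs measurable_Us).
Qed.

Lemma Pr_regular_atom t p z (u : outcome) :
  P (regular_upto t.+1 `&` [set w | past Zs Us t w = p /\ Zs t w = z /\ Us t w = u]) =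
  ((kap q z u)%:E *
   P (regular_upto t `&` [set w | past Zs Us t w = p /\ Zs t w = z]))%E.
Proof. by rewrite -atom_eq KcoP hist_eq. Qed.

(** [kap] already has total mass 1 on outcomes with costs in [cvals], so extending regular histories
    by one sample loses no probability. *)
Lemma Pr_regular_upto t : Pr P (regular_upto t) = 1.
Proof.
elim: t => [|t IH].
  by rewrite -[RHS](PrT P); congr (Pr P _); apply/seteqP; split.
have mpT := measurable_pastT measurable_Zs measurable_Us.
pose V w := (pastT Zs Us t w, Zs t w).
have VE v : [set w | V w = v] = [set w | past Zs Us t w = v.1 /\ Zs t w = v.2].
  apply/seteqP; split=> w /=; first by move=> <-.
  by case: v => p z /= [e1 e2]; rewrite /V e2; congr (_, _); apply: val_inj.
have mV v : measurable [set w | V w = v].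
  by rewrite VE; exact: measurable_past_Zs.
pose VU w := (V w, Us t w).
have VUE v : [set w | VU w = v] = [set w | V w = v.1] `&` [set w | Us t w = v.2].
  by apply/seteqP; split=> w /=; [move=> <-|case: v => v u /= [<- <-]].
have mVU v : measurable [set w | VU w = v].
  by rewrite VUE; apply: measurableI; [exact: mV|exact: measurable_Us].
rewrite (Pr_fin P (measurable_regular_upto t.+1) mVU) big_pair_fin.
rewrite -[RHS]IH (Pr_fin P (measurable_regular_upto t) mV).
apply: eq_bigr => v _.
rewrite -[RHS]mul1r -(kap_sum q cost h T_sum v.2) mulr_suml.
apply: eq_bigr => u _.
have -> : [set w | regular_upto t.+1 w /\ VU w = (v, u)] = regular_upto t.+1 `&`
   [set w | past Zs Us t w = v.1 /\ Zs t w = v.2 /\ Us t w = u].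
  rewrite -[LHS]/(regular_upto t.+1 `&` [set w | VU w = (v, u)]) VUE VE.
  by congr (_ `&` _); apply/seteqP; split=> w /= -[]; [case|move=> ? []].
have -> : [set w | regular_upto t w /\ V w = v] = regular_upto t `&`
   [set w | past Zs Us t w = v.1 /\ Zs t w = v.2].
  by rewrite -VE.
rewrite /Pr Pr_regular_atom fineM // fin_num_measure //.
by apply: measurableI; [exact: measurable_regular_upto|exact: measurable_past_Zs].
Qed.

Lemma full_setI (G B : set Omega) : measurable G -> measurable B -> Pr P G = 1 ->
  P (G `&` B) = P B.
Proof.
move=> mG mB G1.
have nG : P (~` G) = 0%E.
  by rewrite probability_setC // -(PrE P mG) G1 -EFinB subrr.
rewrite [in RHS](_ : B = (G `&` B) `|` (~` G `&` B)).
  rewrite measureU0 //; [exact: measurableI|by apply: measurableI => //; exact: measurableC|].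
  apply/eqP; rewrite eq_le measure_ge0 andbT -nG.
  by apply: le_measure; rewrite ?inE //; [apply: measurableI => //|]; exact: measurableC.
by rewrite -setIUl setUv setTI.
Qed.

(** Regularity being almost sure, it can be removed from both sides of [Pr_regular_atom]. *)
Lemma kapP t p z u :
  P [set w | past Zs Us t w = p /\ Zs t w = z /\ Us t w = u] =
  ((kap q z u)%:E * P [set w | past Zs Us t w = p /\ Zs t w = z])%E.
Proof.
have mpz := measurable_past_Zs t p z.
have mpu : measurable [set w | past Zs Us t w = p /\ Zs t w = z /\ Us t w = u].
  have -> : [set w | past Zs Us t w = p /\ Zs t w = z /\ Us t w = u] =
    [set w | past Zs Us t w = p /\ Zs t w = z] `&` [set w | Us t w = u].
    by apply/seteqP; split=> w /=; [case=> ? []|case=> -[]].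
  by apply: measurableI => //; exact: measurable_Us.
rewrite -(full_setI (measurable_regular_upto t.+1) mpu) ?Pr_regular_upto //.
by rewrite Pr_regular_atom (full_setI (measurable_regular_upto t) mpz) ?Pr_regular_upto.
Qed.

Lemma regular_ae : {ae P, forall w, forall t, regular_upto t w}.
Proof.
apply: ae_foralln => t; have mr := measurable_regular_upto t.
have P0 : P (~` regular_upto t) = 0%E.
  by rewrite probability_setC // -(PrE P mr) Pr_regular_upto -EFinB subrr.
by exists (~` regular_upto t); split=> //; exact: measurableC.
Qed.

Hypothesis alP : forall t, exists phi, forall w, al t w = phi (hist X Y A C O t w).
Hypothesis al01 : forall t w, 0 <= al t w <= 1.

Lemma rate_of_history : exists rate : seq (state * outcome) -> state -> R,
  (forall p z, 0 <= rate p z <= 1) /\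
  forall t w, regular_upto t w -> al t w = rate (past Zs Us t w) (Zs t w).
Proof.
have [phi phiP] := choice alP.
(* Clipping bounds the rate on histories that are never realised. *)
exists (fun p z => Num.max 0 (Num.min 1 (phi (size p) (map decode (rev p), z)))).
split=> [p z|t w r].
  by rewrite le_max lexx /= ge_max ler01 ge_min lexx.
rewrite size_past -hist_past // -phiP.
by have /andP[a0 a1] := al01 t w; rewrite (min_idPr a1) (max_idPr a0).
Qed.

Hypothesis al_oo : forall x y a, {ae P, forall w,
  (fun N => \sum_(t < N) alv X Y A al t x y a w) @ \oo --> +oo}.
Hypothesis al_sq : forall x y a, {ae P, forall w,
  cvgn (fun N => \sum_(t < N) (alv X Y A al t x y a w) ^+ 2)}.
Variable Q : M -> 'I_k.+1 -> bool -> R.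
Hypothesis QE : Bellman mstar q gamma T cost h Q.

Lemma Qlearning_cvg x y a : {ae P, forall w,
  (fun t => Qit mstar gamma X Y A C O al t w x y a) @ \oo --> Q x y a}.
Proof.
have [rate [rate01 rateP]] := rate_of_history.
have alvE t w z : regular_upto t w ->
    alv X Y A al t z.1.1 z.1.2 z.2 w = rate_at rate z (past Zs Us t w) (Zs t w).
  by move=> r; case: z => [[x1 y1] a1]; rewrite /alv /rate_at -rateP.
pose Qh := Qhist gamma mstar rate.
have QitE t w : (forall t, regular_upto t w) -> forall z,
    Qit mstar gamma X Y A C O al t w z.1.1 z.1.2 z.2 = Qh (past Zs Us t w) z.
  move=> r; elim: t => [|t IH] z //=.
  rewrite (alvE _ _ z (r t)) (IH z) /target regularP; last exact: (r t.+1).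
  by rewrite /zmin -!(IH (_, _)) -surjective_pairing.
pose Qs (z : state) := Q z.1.1 z.1.2 z.2.
have bellQ z : bell T q gamma cost h mstar Qs z = Qs z by rewrite {2}/Qs QE; case: z => [[]].
have bsq z : {ae P, forall w, cvgn (fun N => \sum_(t < N)
    rate_at rate z (past Zs Us t w) (Zs t w) ^+ 2)}.
  apply: filterS2 regular_ae (al_sq z.1.1 z.1.2 z.2) => w r.
  by under eq_fun do under eq_bigr do rewrite alvE //.
(* Accuracies [j.+1%:R^-1] and finitely many [z] leave only countably many null sets to unite. *)
have small : {ae P, forall w, forall z (j : nat), exists m, forall n,
   `|\sum_(m <= s < n) rate_at rate z (past Zs Us s w) (Zs s w) *
      noise q gamma mstar rate z (past Zs Us s w) (Zs s w) (Us s w)| <= j.+1%:R^-1}.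
  apply: filter_forall => z; apply: ae_foralln => j.
  have hj : 0 < j.+1%:R^-1 :> R by rewrite invr_gt0.
  have g0 z1 (u : outcome) : 0 <= kap q z1 u by exact: (kap_ge0 T_ge0 q01 z1 u).
  exact: (noise_small_ae measurable_Zs measurable_Us g0
    (fun z1 => kap_sum q cost h T_sum z1) kapP
    (noise_mean q gamma T_sum mstar rate z)
    (noise_le T_ge0 T_sum q01 gamma01 cost_ge0 cost_le mstar rate01 z) (bsq z) hj).
have oo : {ae P, forall w, forall z : state, (fun N => \sum_(t < N) alv X Y A al t z.1.1 z.1.2 z.2 w) @ \oo --> +oo}.
  by apply: filter_forall => z; exact: al_oo.
apply: filterS3 regular_ae small oo => w r sm ow.
have -> : (fun t => Qit mstar gamma X Y A C O al t w x y a) =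
   (fun t => Qh (past Zs Us t w) (x, y, a)).
  by apply/funext => t; rewrite -(QitE t w r (x, y, a)).
apply: (@contraction_cvg R _ (bell T q gamma cost h mstar) Qs gamma gamma01 _
   (fun t => Qh (past Zs Us t w))
   (fun t z => rate_at rate z (past Zs Us t w) (Zs t w))
   (fun t z => noise q gamma mstar rate z (past Zs Us t w) (Zs t w) (Us t w))
   (cmax / (1 - gamma))).
- move=> f B fB z; rewrite -bellQ.
  exact: bell_contract.
- by move=> t z; exact: rate_at01.
- move=> z; have := ow z.
  rewrite (_ : (fun N => _) = fun N => \sum_(t < N) rate_at rate z (past Zs Us t w) (Zs t w)) //.
  by apply/funext => N; apply: eq_bigr => t _; exact: alvE.
- move=> z e e0; have [j hj] := ltr_add_invr e0; have [m hm] := sm z j.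
  exists m => n; apply: (le_trans (hm n)); rewrite -[leLHS]add0r; exact: ltW.
- by move=> t z; exact: Qhist_step.
- move=> t z.
  have /andP[a0 a1] := Qhist_bounds gamma01 cost_ge0 cost_le mstar rate01 (past Zs Us t w) z.
  have /andP[b0 b1] := Bellman_bounds T_ge0 T_sum q01 gamma01 cost_ge0 cost_le QE z.1.1 z.1.2 z.2.
  rewrite /Qs /Qh; move: a0 a1 b0 b1.
  move: (cmax / (1 - gamma)) (Qhist _ _ _ _ _) (Q _ _ _) => B x1 x2 a0 a1 b0 b1.
  by rewrite ler_norml; apply/andP; split; lra.
Qed.

End QLearning.

(** The unknown model is expressed through [Qit], which reads only the samples, the learning rates,
    [mstar] and [gamma]. *)
Theorem theorem5
  (R : realType) (n : nat) (S W : finType) (E : Type)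
  (f : S -> Mn n S -> W -> S)              (* dynamics s' = f(s, m, w) *)
  (pw : {ffun 'I_n -> W} -> R)             (* joint law of (w^1_t,...,w^n_t) *)
  (p0 : Cfg n S -> R)                      (* law of the initial states *)
  (q gamma : R)
  (cost : Mn n S -> E -> bool -> R)        (* c(m, \hat m, a) *)
  (h : (Mn n S -> R) -> E)                 (* estimate \hat m = h(belief) *)
  (eps cmax : R) (k : nat) (mstar : Mn n S)
  (Qstar : Mn n S -> 'I_k.+1 -> bool -> R) :
  (0 < n)%N ->
  (forall w, 0 <= pw w) -> \sum_(w : {ffun 'I_n -> W}) pw w = 1 ->
  (* exchangeability of the local noises *)
  (forall (sigma : 'S_n) (w : {ffun 'I_n -> W}),
      pw [ffun i => w (sigma i)] = pw w) ->
  (forall c, 0 <= p0 c) -> \sum_(c : Cfg n S) p0 c = 1 ->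
  0 <= q <= 1 -> 0 < gamma < 1 ->
  (forall m mh a, 0 <= cost m mh a) ->
  (forall m mh a, cost m mh a <= cmax) ->
  0 < eps -> 0 < cmax ->
  ln ((1 - gamma) * eps / (2 * cmax)) / ln gamma <= k%:R ->
  Bellman mstar q gamma (Tm f pw) cost h Qstar ->
  (* (a) almost sure convergence of Q-learning *)
  (forall (d : measure_display) (Omega : measurableType d)
          (P : probability Omega R)
          (X : nat -> Omega -> Mn n S) (Y : nat -> Omega -> 'I_k.+1)
          (A : nat -> Omega -> bool) (C : nat -> Omega -> R)
          (O : nat -> Omega -> option (Mn n S)) (al : nat -> Omega -> R),
      (forall t v, measurable [set w | X t w = v]) ->
      (forall t v, measurable [set w | Y t w = v]) ->
      (forall t v, measurable [set w | A t w = v]) ->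
      (forall t v, measurable [set w | C t w = v]) ->
      (forall t v, measurable [set w | O t w = v]) ->
      (* the learning rate is chosen based on the past samples only *)
      (forall t, exists phi, forall w, al t w = phi (hist X Y A C O t w)) ->
      (* given the past, (c', o) is distributed as in the model *)
      (forall t hv (c' : R) (o : option (Mn n S)),
          P [set w | hist X Y A C O t w = hv /\ C t w = c' /\ O t w = o]
          = ((Kco q (Tm f pw) cost h hv.2.1.1 hv.2.1.2 hv.2.2 c' o)%:E
             * P [set w | hist X Y A C O t w = hv])%E) ->
      (forall t w, 0 <= al t w <= 1) ->
      (forall x y a, {ae P, forall w,
          (fun N => \sum_(t < N) alv X Y A al t x y a w) @ \oo --> +oo}) ->
      (forall x y a, {ae P, forall w,
          cvgn (fun N => \sum_(t < N) (alv X Y A al t x y a w) ^+ 2)}) ->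
      (* every (x, y, a) is updated infinitely often *)
      (forall x y a, {ae P, forall w, forall N, exists t,
          (N <= t)%N /\ (X t w, Y t w, A t w) = (x, y, a)}) ->
      forall x y a, {ae P, forall w,
          (fun t => Qit mstar gamma X Y A C O al t w x y a) @ \oo
            --> Qstar x y a})
  /\
  (* (b) greedy strategies are eps-optimal *)
  (forall gs : Mn n S -> 'I_k.+1 -> bool,
      (forall x y a, Qstar x y (gs x y) <= Qstar x y a) ->
      forall g : strategy n S,
        Jcost f pw p0 q gamma cost h (greedy_strategy mstar gs)
          <= Jcost f pw p0 q gamma cost h g + eps).
Proof.
move=> _ pw_ge0 pw_sum pw_exch p0_ge0 p0_sum q01 gamma01 cost_ge0 cost_le eps0 cmax0 kP QE.
have T_ge0 := Tm_ge0 f pw_ge0.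
have T_sum := Tm_sum f pw_sum pw_exch.
split.
  move=> d Omega P X Y A C O al mX mY mA mC mO alP KcoP al01 al_oo al_sq _ x y a.
  exact: (Qlearning_cvg T_ge0 T_sum q01 gamma01 cost_ge0 cost_le mX mY mA mC mO KcoP alP al01
    al_oo al_sq QE).
move=> gs opt g.
have up := Jcost_greedy_le pw_ge0 pw_sum pw_exch p0_ge0 p0_sum q01 gamma01 cost_ge0 cost_le QE opt.
have lo := ge_Jcost pw_ge0 pw_sum pw_exch p0_ge0 p0_sum q01 gamma01 cost_ge0 cost_le QE g.
have err := horizon_error gamma01 eps0 cmax0 kP.
(* Both bounds now refer to the same initial value, and each costs at most [eps / 2]. *)
rewrite (valueE0 _ _ _ _ _ _ _ g) in up.
lra.
Qed.
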